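(* Equip $\mathcal{X}$ either with the box topology or with the concentration topology. Then $\mathcal{X}_* = \mathcal{X}\setminus\{*\}$ is not homeomorphic to $\mathbb{R}_+\times\Sigma$, and $\mathcal{X}$ is not homeomorphic to the cone over $\Sigma$, where $\Sigma=\mathcal{X}_*/\mathbb{R}_+$ carries the quotient topology.
   Context: An mm-space is a triple $(X,d_X,\mu_X)$ where $(X,d_X)$ is a complete separable metric space and $\mu_X$ is a Borel probability measure on $X$. Two mm-spaces $X,Y$ are mm-isomorphic if there is an isometry $f\colon \operatorname{supp}\mu_X\to\operatorname{supp}\mu_Y$ with $f_*\mu_X=\mu_Y$. $\mathcal{X}$ is the set of mm-isomorphism classes of mm-spaces, and every mm-space is assumed to satisfy $X=\operatorname{supp}\mu_X$. Let $I=[0,1)$ with Lebesgue measure $\mathcal{L}^1$. A parameter of $X$ is a Borel map $\varphi\colon I\to X$ with $\varphi_*\mathcal{L}^1=\mu_X$. The box distance $\square(X,Y)$ is the infimum of $\varepsilon\ge0$ such that there exist parameters $\varphi$ of $X$, $\psi$ of $Y$ and a Borel set $I_0\subset I$ with $\mathcal{L}^1(I_0)\ge 1-\varepsilon$ and $|d_X(\varphi(s),\varphi(t))-d_Y(\psi(s),\psi(t))|\le\varepsilon$ for all $s,t\in I_0$. It is a metric on $\mathcal{X}$, and the box topology is the topology it induces. For measurable $f,g\colon I\to\mathbb{R}$, the Ky Fan metric is $d_{KF}(f,g)=\inf\{\varepsilon\ge0 : \mathcal{L}^1(\{|f-g|>\varepsilon\})\le\varepsilon\}$. The observable distance is $d_{\mathrm{conc}}(X,Y)=\inf_{\varphi,\psi}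 d_H(\{f\circ\varphi : f\colon X\to\mathbb{R}\text{ 1-Lipschitz}\},\{g\circ\psi : g\colon Y\to\mathbb{R}\text{ 1-Lipschitz}\})$, where $\varphi,\psi$ range over parameters of $X,Y$ and $d_H$ is the Hausdorff distance with respect to $d_{KF}$. It is a metric on $\mathcal{X}$, and the concentration topology is the topology it induces. The multiplicative group $\mathbb{R}_+=(0,\infty)$ acts on $\mathcal{X}$ by $tX=(X,t\,d_X,\mu_X)$. The one-point mm-space $*$ is its only fixed point. Set $\mathcal{X}_*=\mathcal{X}\setminus\{*\}$ and $\Sigma=\mathcal{X}_*/\mathbb{R}_+$ with the quotient topology. The cone over $\Sigma$ is $(\Sigma\times[0,\infty))/(\Sigma\times\{0\})$. *)

(* Defs.v *)
From mathcomp Require Import all_boot all_algebra all_classical all_reals all_analysis.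
From mathcomp Require Import Rstruct Rstruct_topology.
Import Num.Theory GRing.Theory.
Set Implicit Arguments.
Unset Strict Implicit.
Unset Printing Implicit Defensive.
Local Open Scope classical_set_scope.
Local Open Scope ring_scope.

Notation R := Rdefinitions.R.

Section MetricNotions.
Variables (T : Type) (d : T -> T -> R).

Definition is_metric : Prop :=
  [/\ forall x, d x x = 0,
      forall x y, d x y = 0 -> x = y,
      forall x y, d x y = d y x &
      forall x y z, d x z <= d x y + d y z].

Definition mball (x : T) (r : R) : set T := [set y | d x y < r].

Definition mopen (U : set T) : Prop :=
  forall x, U x -> exists r, 0 < r /\ mball x r `<=` U.

Definition mborel : set (set T) := <<s mopen >>.

Definition complete_metric : Prop :=
  forall u : nat -> T,
    (forall e, 0 < e -> exists N, forall m n, (N <= m)%N -> (N <= n)%N ->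
       d (u m) (u n) < e) ->
    exists x, forall e, 0 < e -> exists N, forall n, (N <= n)%N -> d (u n) x < e.

Definition separable_metric : Prop :=
  exists s : nat -> T, forall x e, 0 < e -> exists n, d x (s n) < e.

(* mu is a Borel probability measure (its values on non-Borel sets are
   irrelevant) *)
Definition borel_probability (mu : set T -> R) : Prop :=
  [/\ mu set0 = 0,
      forall A, mborel A -> 0 <= mu A,
      forall F : nat -> set T, (forall n, mborel (F n)) -> trivIset setT F ->
        (fun n => \sum_(k < n) mu (F k)) @ \oo --> mu (\bigcup_k F k) &
      mu setT = 1].

Definition full_support (mu : set T -> R) : Prop :=
  forall x r, 0 < r -> 0 < mu (mball x r).

End MetricNotions.

Record mmspace := MMSpace {
  mm_pt :> Type;
  mm_d : mm_pt -> mm_pt -> R;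
  mm_mu : set mm_pt -> R;
  mm_metric : is_metric mm_d;
  mm_complete : complete_metric mm_d;
  mm_separable : separable_metric mm_d;
  mm_prob : borel_probability mm_d mm_mu;
  mm_supp : full_support mm_d mm_mu
}.
Arguments mm_d : clear implicits.
Arguments mm_mu : clear implicits.

(* f : X -> Y is an mm-isomorphism from tX = (X, t d_X, mu_X) to Y *)
Definition mm_iso_scaled (t : R) (X Y : mmspace) : Prop :=
  exists f : X -> Y,
    (forall x y, mm_d Y (f x) (f y) = t * mm_d X x y) /\
    (forall B, mborel (mm_d Y) B -> mm_mu X (f @^-1` B) = mm_mu Y B).

Definition mm_iso (X Y : mmspace) : Prop := mm_iso_scaled 1 X Y.

Definition one_point (X : mmspace) : Prop := exists x : X, forall y : X, y = x.

Definition I01 : set R := `[0, 1[%classic.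

Definition leb (A : set R) : \bar R := lebesgue_measure A.

Definition Rborel (A : set R) : Prop :=
  (measurable : set (set (measurableTypeR R))) A.

(* phi : I -> X (values outside I are irrelevant), Borel, with
   phi_* (Lebesgue on I) = mu_X *)
Definition parameter (X : mmspace) (phi : R -> X) : Prop :=
  forall B, mborel (mm_d X) B ->
    Rborel (I01 `&` phi @^-1` B) /\
    leb (I01 `&` phi @^-1` B) = (mm_mu X B)%:E.

Definition box_dist (X Y : mmspace) : R :=
  inf [set e : R | 0 <= e /\
    exists (phi : R -> X) (psi : R -> Y) (I0 : set R),
      [/\ parameter phi, parameter psi, Rborel I0, I0 `<=` I01 &
          ((1 - e)%R%:E <= leb I0)%E /\
          forall s t, I0 s -> I0 t ->
            `|mm_d X (phi s) (phi t) - mm_d Y (psi s) (psi t)| <= e]].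

Definition dKF (f g : R -> R) : R :=
  inf [set e : R | 0 <= e /\
    (leb (I01 `&` [set s | (e < `|f s - g s|)%R]) <= e%:E)%E].

Definition hausdorff_KF (A B : set (R -> R)) : R :=
  Num.max (sup [set inf [set dKF a b | b in B] | a in A])
          (sup [set inf [set dKF a b | a in A] | b in B]).

Definition lip1 (X : mmspace) : set (X -> R) :=
  [set f | forall x y, `|f x - f y| <= mm_d X x y].

Definition obs (X : mmspace) (phi : R -> X) : set (R -> R) :=
  [set f \o phi | f in @lip1 X].

Definition conc_dist (X Y : mmspace) : R :=
  inf [set e : R | exists (phi : R -> X) (psi : R -> Y),
    [/\ parameter phi, parameter psi & e = hausdorff_KF (obs phi) (obs psi)]].

Definition quot (T : Type) (E : T -> T -> Prop) : Type :=
  {C : set T | exists x, C = E x}.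

Definition qproj (T : Type) (E : T -> T -> Prop) (x : T) : quot E :=
  exist _ (E x) (ex_intro _ x erefl).

Definition qrep (T : Type) (E : T -> T -> Prop) (c : quot E) : T :=
  projT1 (cid (proj2_sig c)).

Record topsp := TopSp { tpt :> Type; topen : set (set tpt) }.
Arguments topen : clear implicits.

Definition tcont (A B : topsp) (f : A -> B) : Prop :=
  forall V, topen B V -> topen A (f @^-1` V).

Definition homeomorphic (A B : topsp) : Prop :=
  exists (f : A -> B) (g : B -> A),
    [/\ cancel f g, cancel g f, tcont f & tcont g].

Definition subspace (A : topsp) (P : set A) : topsp :=
  @TopSp {x : A | P x}
    [set U | exists V, topen A V /\ U = (@proj1_sig A P) @^-1` V].
Arguments subspace : clear implicits.

Definition quotient_top (A : topsp) (E : A -> A -> Prop) : topsp :=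
  @TopSp (quot E) [set U | topen A (qproj E @^-1` U)].

Definition prod_top (A B : topsp) : topsp :=
  @TopSp (A * B)%type
    [set W | forall p, W p -> exists U V,
       [/\ topen A U, topen B V, U p.1, V p.2 & (U `*` V) `<=` W]].

Definition R_top : topsp := @TopSp R [set U | open U].

Definition Rplus_top : topsp := subspace R_top [set x | 0 < x].
Definition Rnonneg_top : topsp := subspace R_top [set x | 0 <= x].

Definition cone (S : topsp) : topsp :=
  quotient_top (A := prod_top S Rnonneg_top)
    (fun p q => p = q \/ (proj1_sig p.2 = 0 /\ proj1_sig q.2 = 0)).

Definition MMX : Type := quot mm_iso.

Definition X_top (delta : mmspace -> mmspace -> R) : topsp :=
  @TopSp MMX (mopen (fun c c' : MMX => delta (qrep c) (qrep c'))).

Definition Xstar_top (delta : mmspace -> mmspace -> R) : topsp :=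
  subspace (X_top delta) [set c | ~ one_point (qrep c)].

(* orbits of the R_+ action  tX = (X, t d_X, mu_X)  on X_* *)
Definition orbit_rel (delta : mmspace -> mmspace -> R) :
    Xstar_top delta -> Xstar_top delta -> Prop :=
  fun c c' => exists t : R, 0 < t /\
    mm_iso_scaled t (qrep (proj1_sig c)) (qrep (proj1_sig c')).

Definition Sigma_top (delta : mmspace -> mmspace -> R) : topsp :=
  quotient_top (orbit_rel (delta := delta)).

(* Main.v *)
(* [Sigma] is not regular.  Let X be two points of mass 1/2 at distance 1, and
   let Z_e be two points of masses 1 - e and e at distance 1.  Orbits meeting the
   ball of radius 1/4 around X form an open neighborhood W of the orbit of X,
   and Z_e is not in W for small e, since every t Z_e is e-close to a point.
   Adding to X a third point of mass e at distance L gives a space which is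
   e-close to X and which, rescaled by 1/L, is (1/L)-close to Z_e; hence the
   closure of every neighborhood of the orbit of X contains the orbit of Z_e for
   all small e.  On the other hand both distances are pseudometrics, and either
   homeomorphism would embed [Sigma] in a pseudometric space, as a slice of
   R_+ x Sigma or of the cone, so that [Sigma] would be regular.

   The triangle inequality for both distances needs two facts: every mm-space
   has a parameter, and any two parameters of a space Y become uniformly close,
   off a set of small measure, after composition with suitable measure
   preserving maps of the unit interval. *)
Require Import Defs.
From mathcomp Require Import all_boot all_order all_algebra all_classical all_reals all_analysis.
From mathcomp Require Import Rstruct Rstruct_topology.
From mathcomp Require Import measurable_realfun.
From HB Require Import structures.
From mathcomp Require Import ring lra.
Import Order.TTheory GRing.Theory Num.Theory.
Import numFieldNormedType.Exports.

Set Implicit Arguments.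
Unset Strict Implicit.
Unset Printing Implicit Defensive.
Local Open Scope classical_set_scope.
Local Open Scope ring_scope.

(** * Binary subdivision of an interval along a sequence of sets *)

(** The measure transported is Lebesgue measure on [J]; an arbitrary [J] allows maps on adjacent
    intervals to be glued. *)
Definition push d (S : measurableType d) (J : set R) (f : R -> S)
    (nu : set S -> \bar R) : Prop :=
  forall B, measurable B ->
    Rborel (J `&` f @^-1` B) /\ leb (J `&` f @^-1` B) = nu B.

Section BinaryCode.
Context d (S : measurableType d) (nu : {finite_measure set S -> \bar R}).
Variable B : nat -> set S.
Hypothesis mB : forall n, measurable (B n).

(** The interval of length [nu A] starting at [a] is cut at [c] into a left part, as long as the
    mass of [A] inside [B k], and a right part, as long as the mass outside. The recursion enters
    the part containing [t]; bit [i] records a left turn at depth [i] and stands for membership in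
    [B (k + i)]. *)
Fixpoint bit (A : set S) (a : R) (k i : nat) (t : R) : bool :=
  let c := a + fine (nu (A `&` B k)) in
  if i is j.+1 then
    if t < c then bit (A `&` B k) a k.+1 j t else bit (A `\` B k) c k.+1 j t
  else t < c.

Definition bits A a k n t := [seq bit A a k i t | i <- iota 0 n].

Definition code k n (x : S) := [seq `[< B i x >] | i <- iota k n].

Lemma bitsS A a k n t : bits A a k n.+1 t =
  let c := a + fine (nu (A `&` B k)) in
  if t < c then true :: bits (A `&` B k) a k.+1 n t
  else false :: bits (A `\` B k) c k.+1 n t.
Proof.
rewrite /bits /= -[1%N]addn0 iotaDl -map_comp.
by case: ifP => tc; congr cons; apply: eq_map => i /=; rewrite tc.
Qed.

Lemma fine_nuID A k : measurable A ->
  fine (nu A) = fine (nu (A `&` B k)) + fine (nu (A `\` B k)).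
Proof.
move=> mA; rewrite -fineD ?fin_num_measure//; last 2 first.
- exact: measurableI.
- exact: measurableD.
- rewrite -measureU; first by rewrite setUIDK.
  + exact: measurableI.
  + exact: measurableD.
  + by rewrite setDE setIACA setICr setI0.
Qed.

(** Sorting points by their first bit splits both sides into two disjoint pieces that match the two
    sides of the cut. The induction changes [A], [a], [k] and the set [P] of admissible words, hence
    the general form. *)
Lemma bits_measure n : forall A a k (P : set (seq bool)), measurable A ->
  [/\ measurable [set x | A x /\ P (code k n x)],
      Rborel [set t | a <= t < a + fine (nu A) /\ P (bits A a k n t)] &
      leb [set t | a <= t < a + fine (nu A) /\ P (bits A a k n t)] =
      nu [set x | A x /\ P (code k n x)]].
Proof.
elim: n => [|n IH] A a k P mA.
  rewrite /code /bits /=; have [PE|nPE] := pselect (P [::]); last first.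
    rewrite (_ : [set x | _] = set0); last by apply/seteqP; split => x //= -[].
    rewrite (_ : [set x | _] = set0); last by apply/seteqP; split => x //= -[].
    by split => //; [exact: measurable0|rewrite /leb !measure0].
  rewrite (_ : [set x | _] = A); last by apply/seteqP; split => x //= -[].
  rewrite (_ : [set x | _] = `[a, a + fine (nu A)[%classic); last first.
    by apply/seteqP; split => x /=; rewrite in_itv /=; [case|].
  split => //; first exact: measurable_itv.
  rewrite /leb lebesgue_measure_itv/= lte_fin.
  have nuA : nu A = (fine (nu A))%:E by rewrite fineK// fin_num_measure.
  have nuA0 : 0 <= fine (nu A) by apply: fine_ge0.
  case: ltP => [_|]; first by rewrite -EFinD addrAC subrr add0r -nuA.
  by rewrite gerDl => le0; rewrite nuA; congr EFin; apply/eqP; rewrite eq_le le0 nuA0.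
have mA1 : measurable (A `&` B k) by exact: measurableI.
have mA2 : measurable (A `\` B k) by exact: measurableD.
set c := a + fine (nu (A `&` B k)).
have [m1 b1 e1] := IH (A `&` B k) a k.+1 [set s | P (true :: s)] mA1.
have [m2 b2 e2] := IH (A `\` B k) c k.+1 [set s | P (false :: s)] mA2.
have nA1 : 0 <= fine (nu (A `&` B k)) by apply: fine_ge0.
have nA2 : 0 <= fine (nu (A `\` B k)) by apply: fine_ge0.
have cE : a + fine (nu A) = c + fine (nu (A `\` B k)).
  by rewrite (fine_nuID k mA) addrA.
rewrite (_ : [set x | _] = [set x | (A `&` B k) x /\ P (true :: code k.+1 n x)]
    `|` [set x | (A `\` B k) x /\ P (false :: code k.+1 n x)]); last first.
  apply/seteqP; split => x /=; rewrite /code /=.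
    by case: asboolP => Bx [Ax Px]; [left|right].
  by case=> -[[Ax Bx] Px]; [rewrite asboolT|rewrite asboolF].
rewrite (_ : [set t | _] =
   [set t | a <= t < c /\ P (true :: bits (A `&` B k) a k.+1 n t)]
    `|` [set t | c <= t < c + fine (nu (A `\` B k)) /\
             P (false :: bits (A `\` B k) c k.+1 n t)]); last first.
  apply/seteqP; split => t /=; rewrite bitsS cE /= -/c.
    case: (ltP t c) => tc [/andP[t1 t2] Pt]; [left|right];
      by split; rewrite ?t1 ?t2.
  case=> -[/andP[t1 t2] Pt].
    by rewrite t2 t1 (lt_le_trans t2) ?lerDl//; split.
  by rewrite (ltNge t c) t1 /= t2 (le_trans _ t1) //; rewrite /c lerDl.
split; [exact: measurableU|exact: measurableU|].
rewrite /leb !measureU//=; first by rewrite -e1 -e2.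
- by apply/seteqP; split => x //= -[[[_ Bx] _] [[_]]].
- apply/seteqP; split => x //= -[[/andP[_ xc] _] [/andP[cx _] _]].
  by rewrite ltNge cx in xc.
Qed.

(** The cell that [t] reaches at depth [n] has positive mass, since its half-open interval contains
    [t]; so it contains a point of [S], which realizes the first [n] bits. *)
Lemma bit_witness n : forall A a k t, measurable A ->
  a <= t < a + fine (nu A) ->
  exists x, A x /\ forall i, (i < n)%N -> bit A a k i t = `[< B (k + i)%N x >].
Proof.
elim: n => [|n IH] A a k t mA /andP[at1 t2].
  have : A !=set0.
    apply/set0P/eqP => A0; move: t2; rewrite A0 measure0 addr0.
    by rewrite ltNge at1.
  by case=> x Ax; exists x.
have mA1 : measurable (A `&` B k) by exact: measurableI.
have mA2 : measurable (A `\` B k) by exact: measurableD.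
set c := a + fine (nu (A `&` B k)).
have [tc|ct] := ltP t c.
  have [|x [[Ax Bx] H]] := IH _ a k.+1 t mA1; first by rewrite at1.
  exists x; split => // -[_|i]; rewrite /= -/c tc.
    by rewrite addn0; apply/esym/asboolP.
  by rewrite ltnS => /H ->; rewrite addSnnS.
have [|x [[Ax Bx] H]] := IH _ c k.+1 t mA2.
  by rewrite ct /= -addrA -fine_nuID.
exists x; split => // -[_|i]; rewrite /= -/c ltNge ct /=.
  by rewrite addn0; apply/esym/asboolP.
by rewrite ltnS => /H ->; rewrite addSnnS.
Qed.

(** A finite union is decided by finitely many bits, where [bits_measure] applies; continuity from
    below gives the countable union. *)
Lemma bits_bigcup (a : R) (D : set nat) :
  let E i := [set t | bit setT a 0 i t] in
  let J := `[a, a + fine (nu setT)[%classic in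
  Rborel (J `&` \bigcup_(i in D) E i) /\
  leb (J `&` \bigcup_(i in D) E i) = nu (\bigcup_(i in D) B i).
Proof.
move=> E J.
pose P n := [set s : seq bool | exists2 i, D i /\ (i < n)%N & nth false s i].
pose En n := [set t | a <= t < a + fine (nu setT) /\ P n (bits setT a 0 n t)].
pose Bn n := [set x | setT x /\ P n (code 0 n x)].
have H n : [/\ measurable (Bn n), Rborel (En n) & leb (En n) = nu (Bn n)].
  exact: bits_measure.
have EnE n t : En n t <-> J t /\ exists2 i, D i /\ (i < n)%N & E i t.
  rewrite /En /P /J /= in_itv /=; split=> -[Jt [i [Di iltn] Et]]; (split; first by []);
    exists i => //; move: Et; rewrite /bits (nth_map 0%N) ?size_iota//;
    by rewrite nth_iota// add0n.
have BnE n x : Bn n x <-> exists2 i, D i /\ (i < n)%N & B i x.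
  rewrite /Bn /P /=; split=> [[_]|] [i [Di iltn]].
    by rewrite (nth_map 0%N) ?size_iota// nth_iota// add0n => /asboolP; exists i.
  by move=> Bix; split=> //; exists i => //;
    rewrite (nth_map 0%N) ?size_iota// nth_iota// add0n; apply/asboolP.
have EU : J `&` \bigcup_(i in D) E i = \bigcup_n En n.
  apply/seteqP; split=> [t [Jt [i Di Et]]|t [n _ /EnE[Jt [i [Di _] Et]]]].
    by exists i.+1 => //; apply/EnE; split => //; exists i.
  by split => //; exists i.
have BU : \bigcup_(i in D) B i = \bigcup_n Bn n.
  apply/seteqP; split=> [t [i Di Et]|t [n _ /BnE[i [Di _] Et]]].
    by exists i.+1 => //; apply/BnE; exists i.
  by exists i.
rewrite EU BU; split; first by apply: bigcupT_measurable => n; case: (H n).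
have cE : (leb \o En) @ \oo --> leb (\bigcup_n En n).
  apply: nondecreasing_cvg_mu => [n|//|m n mn]; first by case: (H n).
    by apply: bigcupT_measurable => n; case: (H n).
  apply/subsetPset => t /EnE [Jt [i [Di im] Et]]; apply/EnE; split=> //.
  by exists i => //; split=> //; exact: leq_trans mn.
have cB : (nu \o Bn) @ \oo --> nu (\bigcup_n Bn n).
  apply: nondecreasing_cvg_mu => [n|//|m n mn]; first by case: (H n).
    by apply: bigcupT_measurable => n; case: (H n).
  apply/subsetPset => t /BnE [i [Di im] Et]; apply/BnE.
  by exists i => //; split=> //; exact: leq_trans mn.
apply: cvg_unique cE _ => //.
by rewrite (_ : leb \o En = nu \o Bn)//; apply/funext => n /=; case: (H n).
Qed.

End BinaryCode.

(** * Every finite Borel measure on a Polish space is an image of an interval *)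

Lemma leb_fin_itv (a b : R) (A : set R) : Rborel A -> A `<=` `[a, b[%classic ->
  leb A \is a fin_num.
Proof.
move=> mA AI; rewrite ge0_fin_numE; last by exact: measure_ge0.
apply: (@le_lt_trans _ _ (leb `[a, b[%classic)).
  by apply: le_measure => //; rewrite inE.
by rewrite /leb lebesgue_measure_itv/=; case: ifP => _; rewrite ?ltry.
Qed.

Lemma leb_itvco (a m : R) : 0 <= m -> leb `[a, a + m[%classic = m%:E.
Proof.
move=> m0; rewrite /leb lebesgue_measure_itv/= lte_fin ltrDl.
case: ltP => [_|mle0]; first by rewrite -EFinD addrAC subrr add0r.
by congr EFin; apply/eqP; rewrite eq_le m0.
Qed.

Lemma leb_eq_mod_null (A A' N : set R) : Rborel A -> Rborel A' -> Rborel N ->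
  leb N = 0%E -> A `\` N = A' `\` N -> leb A = leb A'.
Proof.
move=> mA mA' mN N0 AA'.
have H C : Rborel C -> leb C = leb (C `\` N).
  move=> mC; rewrite /leb (measureDI _ mC mN) -[RHS]adde0; congr (_ + _)%E.
  apply/eqP; rewrite eq_le measure_ge0 andbT -N0.
  exact: (measureIr lebesgue_measure mC mN).
by rewrite (H _ mA) (H _ mA') AA'.
Qed.

Lemma mball_mopen (T : Type) (d : T -> T -> R) (x : T) (r : R) :
  (forall x y z, d x z <= d x y + d y z) -> mopen d (mball d x r).
Proof.
move=> d_tri y xy; exists (r - d x y); split; first by rewrite subr_gt0.
move=> z; rewrite /mball /= ltrBrDl; exact: le_lt_trans (d_tri x y z).
Qed.

Section MetricTopology.
Variables (T : Type) (d : T -> T -> R).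
Hypothesis dm : is_metric d.

Lemma metric_ge0 x y : 0 <= d x y.
Proof.
case: dm => d0 _ ds dt; have := dt x y x; rewrite d0 (ds y x).
by rewrite -mulr2n pmulrn_lge0.
Qed.

Lemma mopenI (U V : set T) : mopen d U -> mopen d V -> mopen d (U `&` V).
Proof.
move=> oU oV x [/oU[r [r0 rU]] /oV[s [s0 sV]]].
exists (Num.min r s); split; first by rewrite lt_min r0.
by move=> y; rewrite /mball /= lt_min => /andP[xr xs]; split; [apply: rU|apply: sV].
Qed.

End MetricTopology.

(** Open sets form a pi-system generating the Borel sets, so Dynkin's theorem applies; the open set
    [setT] supplies the equality of total masses needed for complements. *)
Lemma push_mopen disp (S : measurableType disp) (dist : S -> S -> R)
    (nu : {finite_measure set S -> \bar R}) (a : R) (phi : R -> S) :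
  let J := `[a, a + fine (nu setT)[%classic in
  (measurable : set (set S)) = mborel dist ->
  (forall U, mopen dist U ->
    Rborel (J `&` phi @^-1` U) /\ leb (J `&` phi @^-1` U) = nu U) ->
  push J phi nu.
Proof.
move=> J bE HU.
have nu_fin A : measurable A -> nu A \is a fin_num by exact: fin_num_measure.
have JT : leb J = nu setT.
  have oT : mopen dist setT by move=> x _; exists 1.
  by have [_ <-] := HU _ oT; rewrite preimage_setT setIT.
suff H B : mborel dist B -> Rborel (J `&` phi @^-1` B) /\ leb (J `&` phi @^-1` B) = nu B.
  by move=> B mB; apply: H; rewrite -bE.
move: B; apply: dynkin_induction => //.
- by move=> U V; exact: mopenI.
- by rewrite preimage_setT setIT; split => //; exact: measurable_itv.
- move=> B mB [bB eB].
  have CE : J `&` phi @^-1` (~` B) = J `\` (J `&` phi @^-1` B).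
    apply/seteqP; split=> t [Jt nB]; split => //; first by case.
    by move=> Bt; apply: nB.
  rewrite CE; split; first by apply: measurableD => //; exact: measurable_itv.
  rewrite /leb measureD//=; last 2 first.
    exact: measurable_itv.
    by have := nu_fin setT measurableT; rewrite -JT /leb ge0_fin_numE// measure_ge0.
  rewrite -[~` B]setTD (measureD measurableT mB); last first.
    by have := nu_fin setT measurableT; rewrite ge0_fin_numE.
  rewrite setIA setIid setTI; congr (_ - _)%E; [exact: JT|exact: eB].
- move=> F mF tF HF.
  have bE' : J `&` phi @^-1` (\bigcup_k F k) = \bigcup_k (J `&` phi @^-1` F k).
    by rewrite preimage_bigcup setI_bigcupr.
  rewrite bE'; split; first by apply: bigcupT_measurable => k; case: (HF k).
  rewrite /leb measure_bigcup//=; last 2 first.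
    by move=> k _; case: (HF k).
    move=> i j _ _ [t [[_ ti] [_ tj]]]; apply: (tF i j) => //.
    by exists (phi t).
  rewrite measure_bigcup//.
  by apply: eq_eseriesr => i _; have [_] := HF i.
Qed.

Section PushExists.
Context disp (S : measurableType disp) (dist : S -> S -> R).
Hypothesis dm : is_metric dist.
Hypothesis dc : complete_metric dist.
Hypothesis ds : separable_metric dist.
Hypothesis bE : (measurable : set (set S)) = mborel dist.

(* A point of [J] follows the binary subdivision of [S] by a countable family
   of balls; outside a null set it meets balls of arbitrarily small radius, so
   that completeness yields a limit point. *)
Lemma push_exists (nu : {finite_measure set S -> \bar R}) (a : R) :
  exists phi : R -> S, push `[a, a + fine (nu setT)[%classic phi nu.
Proof.
have [s s_dense] := ds.
case: (dm) => d0 d_eq d_sym d_tri.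
set J := `[a, a + fine (nu setT)[%classic.
have [rad [rad0 rad_lt]] : exists rad : nat -> R, (forall k, 0 < rad k) /\
    forall e : R, 0 < e -> exists k, rad k < e.
  exists (fun k => k.+1%:R^-1); split=> [k|e /ltr_add_invr[k]].
    by rewrite invr_gt0.
  by rewrite add0r; exists k.
(* One sequence has to list the balls of every center [s i] and every radius [rad k], hence the
   coding of pairs. *)
pose B n := if unpickle n is Some (i, k) then mball dist (s i) (rad k) else set0.
have BE (i k : nat) : B (pickle (i, k)) = mball dist (s i) (rad k) by rewrite /B pickleK.
have omeas U : mopen dist U -> measurable U.
  by move=> oU; rewrite bE; exact: sub_sigma_algebra.
have mB n : measurable (B n).
  rewrite /B; case: unpickle => [[i k]|//].
  by apply: omeas; exact: mball_mopen.
pose E n := [set t | bit nu B setT a 0 n t].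
have EP (D : set nat) : Rborel (J `&` \bigcup_(i in D) E i) /\
    leb (J `&` \bigcup_(i in D) E i) = nu (\bigcup_(i in D) B i).
  exact: bits_bigcup.
pose Rk (k : nat) := [set n | exists i : nat, n = pickle (i, k)].
pose good t := forall k : nat, exists i : nat, E (pickle (i, k)) t.
(* For good [t], witnesses [x n] of longer and longer prefixes eventually share a ball of each
   radius, so they are Cauchy. Their limit lies in every closed ball recorded by [t]. *)
have lim_ex t : exists y, J t /\ good t ->
    forall i k : nat, E (pickle (i, k)) t -> dist (s i) y <= rad k.
  have [[Jt gt]|?] := pselect (J t /\ good t); last by exists (s 0%N).
  have /choice[x xP] : forall n, exists x, forall i, (i < n)%N ->
      bit nu B setT a 0 i t = `[< B i x >].
    have Jt' : a <= t < a + fine (nu setT) by move: Jt; rewrite /J /= in_itv.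
    move=> n; have [x [_ xP]] := bit_witness mB n 0 measurableT Jt'.
    by exists x => i /xP; rewrite add0n.
  have xB (i k n : nat) : E (pickle (i, k)) t -> (pickle (i, k) < n)%N ->
      dist (s i) (x n) < rad k.
    by rewrite /E /= => + ltn; rewrite (xP _ _ ltn) => /asboolP; rewrite BE.
  have [e e0|y yP] := dc (u := x).
    have [k ke] := rad_lt (e / 2) (divr_gt0 e0 (ltr0Sn R 1)).
    have [i Ei] := gt k; exists (pickle (i, k)).+1 => m n /(xB _ _ _ Ei) im /(xB _ _ _ Ei) i_n.
    have := d_tri (x m) (s i) (x n); rewrite (d_sym (x m) (s i)).
    by lra.
  exists y => _ i k Ei; apply/ler_addgt0Pr => e /yP[N NP].
  pose n := maxn N (pickle (i, k)).+1.
  have := NP n (leq_maxl _ _); have := xB _ _ n Ei (leq_maxr _ _).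
  by have := d_tri (s i) (x n) y; lra.
(* All other points go to [s 0], so that on the exceptional set a preimage is everything or nothing,
   hence measurable. *)
have /choice[phi phiP] : forall t, exists y, (J t /\ good t ->
    forall i k : nat, E (pickle (i, k)) t -> dist (s i) y <= rad k) /\
    (~ (J t /\ good t) -> y = s 0%N).
  move=> t; have [y yP] := lim_ex t.
  have [Jg|nJg] := pselect (J t /\ good t); first by exists y; split => // /(_ Jg).
  by exists (s 0%N); split => // /nJg.
exists phi.
pose F k := J `&` \bigcup_(i in Rk k) E i.
have BT k : \bigcup_(i in Rk k) B i = setT.
  apply/seteqP; split=> // x _; have [i xi] := s_dense x _ (rad0 k).
  by exists (pickle (i, k)); [exists i|rewrite BE /mball /= d_sym].
pose N := \bigcup_k (J `\` F k).
have mJ : Rborel J by exact: measurable_itv.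
have JT : leb J = nu setT.
  by rewrite leb_itvco ?fineK ?fin_num_measure//; apply: fine_ge0.
have mN : Rborel N.
  by apply: bigcupT_measurable => k; apply: measurableD => //; case: (EP (Rk k)).
(* For each [k] the balls of radius [rad k] cover [S], so [F k] has full measure in [J]. *)
have N0 : leb N = 0%E.
  apply/negligibleP => //; apply: negligible_bigcup => k; apply/negligibleP.
    by apply: measurableD => //; case: (EP (Rk k)).
  have [mF] := EP (Rk k); rewrite BT -/(F k) => eF.
  rewrite measureD//=; last first.
    by rewrite [X in (X < _)%E]JT ltey_eq fin_num_measure.
  rewrite (_ : J `&` F k = F k); last by rewrite /F setIA setIid.
  by rewrite [X in (X - _)%E]JT -eF subee// (leb_fin_itv mF (a := a) (b := a + fine (nu setT)))// => t [].
have Ngood t : J t -> ~ N t -> good t.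
  move=> Jt nN k; apply: contrapT => nE; apply: nN; exists k => //; split=> // -[_ [n [i ->]]] Ei.
  by apply: nE; exists i.
have NgoodN t : N t -> ~ (J t /\ good t).
  by case=> k _ [Jt nF] [_ gt]; apply: nF; split => //; have [i Ei] := gt k;
    exists (pickle (i, k)) => //; exists i.
apply: (push_mopen (dist := dist)) => // U oU.
(* Closed balls inside [U] are required because the limit defining [phi t] satisfies only the weak
   inequality. *)
pose SU := [set n | exists i k : nat, n = pickle (i, k) /\ [set y | dist (s i) y <= rad k] `<=` U].
have small x (r : R) : 0 < r -> mball dist x r `<=` U -> exists k,
    forall i, dist (s i) x <= rad k -> [set y | dist (s i) y <= rad k] `<=` U.
  move=> r0 rU; have [k kr] := rad_lt (r / 2) (divr_gt0 r0 (ltr0Sn R 1)).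
  exists k => i xi y yi; apply: rU.
  by rewrite /mball /=; have := d_tri x (s i) y; rewrite (d_sym x (s i)); move: yi => /=; lra.
have BU : \bigcup_(i in SU) B i = U.
  apply/seteqP; split=> [x [_ [i [k [-> sU]]]]|x Ux].
    by rewrite BE /mball /= => /ltW xi; exact: sU.
  have [r [r0 rU]] := oU _ Ux; have [k kP] := small _ _ r0 rU.
  have [i xi] := s_dense x _ (rad0 k); rewrite d_sym in xi.
  exists (pickle (i, k)); last by rewrite BE.
  by exists i, k; split => //; apply: kP; exact: ltW.
have phiU t : J t -> ~ N t -> U (phi t) <-> (\bigcup_(i in SU) E i) t.
  move=> Jt nN; have gt := Ngood _ Jt nN; have [+ _] := phiP t.
  move=> /(_ (conj Jt gt)) phit; split=> [Ut|[_ [i [k [-> sU]]]] Et]; last first.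
    exact/sU/phit.
  have [r [r0 rU]] := oU _ Ut; have [k kP] := small _ _ r0 rU.
  have [i Ei] := gt k; exists (pickle (i, k)) => //.
  by exists i, k; split => //; apply: kP; exact: phit.
have [mEU] := EP SU; rewrite BU => <-.
pose M := if `[< U (s 0%N) >] then N else set0.
have mM : Rborel M by rewrite /M; case: ifP => _ //; exact: measurable0.
have NJ : N `<=` J by move=> t [k _ []].
have UE : J `&` phi @^-1` U = ((J `&` \bigcup_(i in SU) E i) `\` N) `|` M.
  apply/seteqP; split=> t.
    move=> [Jt Ut]; have [Nt|nN] := pselect (N t).
      have [_ /(_ (NgoodN _ Nt)) pt] := phiP t; right.
      by rewrite /M asboolT // -pt.
    by left; split => //; split => //; apply/phiU.
  case=> [[[Jt Et] nN]|]; first by split => //; apply/phiU.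
  rewrite /M; case: asboolP => // Us Nt; split; first exact: NJ.
  by have [_ /(_ (NgoodN _ Nt)) pt] := phiP t; rewrite /= pt.
have mPU : Rborel (J `&` phi @^-1` U).
  by rewrite UE; apply: measurableU => //; exact: measurableD.
split=> //; apply: (leb_eq_mod_null mPU mEU mN N0).
apply/seteqP; split=> t [[Jt Ut] nN]; split => //; split => //; exact/phiU.
Qed.

End PushExists.

(** * Parameters *)

Lemma push_comp d (S S' : measurableType d) J f (nu : set S -> \bar R)
    (g : S -> S') (nu' : set S' -> \bar R) :
  push J f nu ->
  (forall B, measurable B -> measurable (g @^-1` B) /\ nu (g @^-1` B) = nu' B) ->
  push J (g \o f) nu'.
Proof.
move=> pf Hg B /Hg[mgB gB]; have [bB eB] := pf _ mgB.
by rewrite comp_preimage; split => //; rewrite eB.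
Qed.

Lemma push_cat d (S : measurableType d) a m1 m2 f1 f2
    (nu1 nu2 nu : set S -> \bar R) : 0 <= m1 -> 0 <= m2 ->
  push `[a, a + m1[%classic f1 nu1 ->
  push `[a + m1, a + m1 + m2[%classic f2 nu2 ->
  (forall B, measurable B -> nu B = (nu1 B + nu2 B)%E) ->
  push `[a, a + (m1 + m2)[%classic (fun t => if t < a + m1 then f1 t else f2 t) nu.
Proof.
move=> m10 m20 p1 p2 nuE B mB; have [b1 e1] := p1 _ mB; have [b2 e2] := p2 _ mB.
rewrite (_ : _ `&` _ = (`[a, a + m1[%classic `&` f1 @^-1` B) `|`
    (`[a + m1, a + m1 + m2[%classic `&` f2 @^-1` B)); last first.
  apply/seteqP; split=> t /=; rewrite !in_itv /= addrA.
    by case: (ltP t (a + m1)) => t1 [/andP[at1 t2] Bt]; [left|right]; rewrite ?at1 ?t2.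
  case=> -[/andP[t1 t2] Bt].
    by rewrite t1 t2 (lt_le_trans t2)// lerDl.
  by rewrite t2 ltNge t1 (le_trans _ t1)// lerDl.
split; first exact: measurableU.
rewrite /leb measureU//; first by rewrite nuE// -e1 -e2.
apply/seteqP; split=> t //= -[[+ _] [+ _]]; rewrite !in_itv /= => /andP[_ t1] /andP[t2 _].
by rewrite ltNge t2 in t1.
Qed.

(** * The real line as a complete separable metric space *)

Definition distR (x y : R) := `|x - y|.

Lemma distR_metric : is_metric distR.
Proof.
split=> [x|x y|x y|x y z]; rewrite /distR.
- by rewrite subrr normr0.
- by move=> /eqP; rewrite normr_eq0 subr_eq0 => /eqP.
- by rewrite distrC.
- exact: ler_distD.
Qed.

Lemma real_cauchy_cvg (K : realType) (u : nat -> K) :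
  (forall e, 0 < e -> exists N, forall m n, (N <= m)%N -> (N <= n)%N ->
     `|u m - u n| < e) ->
  exists x, forall e, 0 < e -> exists N, forall n, (N <= n)%N -> `|u n - x| < e.
Proof.
move=> Hu; have : cauchy (u @ \oo).
  apply: cauchy_exP => e e0; have [N NP] := Hu e e0.
  by exists (u N), N => // n /= Nn; apply: NP.
move=> /(@cauchy_cvg K _ _) cu; exists (lim (u @ \oo)) => e e0.
have [N _ NP] := (cvgrPdistC_lt _ _).1 cu e e0.
by exists N => n Nn; apply: NP.
Qed.

Lemma distR_complete : complete_metric distR.
Proof. by move=> u /(@real_cauchy_cvg R). Qed.

Lemma distR_separable : separable_metric distR.
Proof.
exists (fun n => if unpickle n is Some q then ratr q else 0) => x e e0.
have [|q] := @rat_in_itvoo R (x - e) (x + e); first by lra.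
rewrite in_itv /= => /andP[q1 q2]; exists (pickle q).
by rewrite pickleK /distR ltr_norml; apply/andP; split; lra.
Qed.

Lemma mopen_distR (U : set R) : mopen distR U <-> open U.
Proof.
rewrite openE; split=> oU x Ux.
  have [r [r0 rU]] := oU _ Ux; apply/nbhs_ballP; exists r => //.
by have /nbhs_ballP[r /= r0 rU] := oU _ Ux; exists r.
Qed.

Lemma Rborel_mborel : (measurable : set (set (measurableTypeR R))) = mborel distR.
Proof.
apply/seteqP; split.
  rewrite [X in X `<=` _](RGenOpens.measurableE R).
  apply: smallest_sub; first exact: smallest_sigma_algebra.
  move=> A [x [y ->]]; apply: sub_sigma_algebra.
  by apply/mopen_distR; exact: interval_open.
apply: smallest_sub; first exact: sigma_algebra_measurable.
by move=> U /mopen_distR; exact: open_measurable.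
Qed.

Definition lebI (D C : set (measurableTypeR R)) : \bar R := leb (C `&` D).

(** This is [push_exists] on the real line for Lebesgue measure restricted to [D]. Resetting values
    outside [I01] to [0] leaves the image measure unchanged, since [D] lies in [I01]. *)
Lemma push_sub_I01 (D : set R) (a : R) : Rborel D -> D `<=` I01 ->
  exists f : R -> measurableTypeR R,
    push `[a, a + fine (leb D)[%classic f (lebI D) /\ forall u, I01 (f u).
Proof.
move=> mD DI.
have Doo : (lebesgue_measure (D : set (measurableTypeR R)) < +oo)%E.
  have := @leb_fin_itv 0 1 D mD DI.
  by rewrite ge0_fin_numE//; exact: measure_ge0.
have mI : Rborel I01 by exact: measurable_itv.
have [f pf] := @push_exists _ (measurableTypeR R) distR distR_metric
  distR_complete distR_separable Rborel_mborel (mfrestr mD Doo) a.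
rewrite /= /mfrestr /mrestr setTI in pf.
pose g (u : measurableTypeR R) : measurableTypeR R := if `[< I01 u >] then u else 0.
exists (g \o f); split; last first.
  move=> u; rewrite /= /g; case: asboolP => // _.
  by rewrite /I01 /= in_itv /= lexx ltr01.
apply: push_comp pf _ => B mB.
have gE : g @^-1` B = (B `&` I01) `|` (if `[< B 0 >] then ~` I01 else set0).
  apply/seteqP; split=> t; rewrite /preimage /= /g.
    by case: asboolP => It Bt; [left|right; rewrite asboolT].
  by case=> [[Bt It]|]; [rewrite asboolT|case: asboolP => // B0 It; rewrite asboolF].
split.
  rewrite gE; apply: measurableU; first exact: measurableI.
  by case: ifP => _ //; exact: measurableC.
congr leb; rewrite gE; apply/seteqP; split=> t.
  by move=> [[[]|] // + Dt]; case: ifP => // _ /(_ (DI _ Dt)).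
by move=> [Bt Dt]; split => //; left; split => //; exact: DI.
Qed.

(** * The Borel measure of an mm-space and the existence of parameters *)

Section MmMeasure.
Variable X : mmspace.

Lemma mm_inhabited : exists x : X, True.
Proof. by have [s _] := mm_separable X; exists (s 0%N). Qed.

Definition mm_carrier : Type := mm_pt X.

HB.instance Definition _ := gen_eqMixin mm_carrier.
HB.instance Definition _ := gen_choiceMixin mm_carrier.
HB.instance Definition _ := isPointed.Build mm_carrier (projT1 (cid mm_inhabited)).

Definition mm_meas := g_sigma_algebraType (mopen (mm_d X) : set (set mm_carrier)).

(* [mm_mu X] is unconstrained off the Borel sets, where truncation restores the
   nonnegativity that [isMeasure] requires of every set. *)
Definition mm_nu (A : set mm_meas) : \bar R := (Num.max 0 (mm_mu X A))%:E.

Lemma mm_nuE (A : set mm_meas) : measurable A -> mm_nu A = (mm_mu X A)%:E.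
Proof.
by move=> mA; have [_ mu0 _ _] := mm_prob X; rewrite /mm_nu max_r// mu0.
Qed.

Let mm_nu0 : mm_nu set0 = 0%E.
Proof. by rewrite mm_nuE//; have [-> _ _ _] := mm_prob X. Qed.

Let mm_nu_ge0 A : (0 <= mm_nu A)%E.
Proof. by rewrite lee_fin le_max lexx. Qed.

Let mm_nu_sigma : semi_sigma_additive mm_nu.
Proof.
move=> F mF tF mUF; rewrite mm_nuE//.
have [_ _ + _] := mm_prob X => /(_ F mF tF) cF.
rewrite (_ : (fun n => _) = EFin \o (fun n => \sum_(k < n) mm_mu X (F k))).
  by apply: cvg_EFin; [exact: nearW|exact: cF].
apply/funext => n /=; rewrite big_mkord -sumEFin.
by apply: eq_bigr => i _; exact: mm_nuE.
Qed.

HB.instance Definition _ := isMeasure.Build _ mm_meas R mm_nu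
  mm_nu0 mm_nu_ge0 mm_nu_sigma.

Let mm_nu_fin : fin_num_fun mm_nu. Proof. by []. Qed.

HB.instance Definition _ := Measure_isFinite.Build _ mm_meas R mm_nu mm_nu_fin.

Lemma mm_nuT : mm_nu setT = 1%E.
Proof. by rewrite mm_nuE//; have [_ _ _ ->] := mm_prob X. Qed.

Lemma parameterP (phi : R -> X) :
  parameter phi <-> push I01 (phi : R -> mm_meas) mm_nu.
Proof. by split=> H B mB; have := H B mB; rewrite mm_nuE. Qed.

Lemma parameter_exists : exists phi : R -> X, parameter phi.
Proof.
have [phi pphi] := @push_exists _ mm_meas (mm_d X) (mm_metric X)
  (@mm_complete X) (mm_separable X) erefl mm_nu 0.
exists phi; apply/parameterP.
rewrite (_ : I01 = `[0, 0 + fine (mm_nu setT)[%classic); first exact: pphi.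
by rewrite mm_nuT /= add0r.
Qed.

End MmMeasure.

(** * Approximate couplings of two parameters *)

(** The range lies in [I01] everywhere, so that precomposing a parameter never leaves the interval
    on which it is controlled. *)
Definition preserves_leb (f : R -> R) : Prop :=
  push I01 (f : R -> measurableTypeR R) (lebI I01) /\ forall u, I01 (f u).

Lemma mborel_mball (X : mmspace) (x : X) r : mborel (mm_d X) (mball (mm_d X) x r).
Proof.
by apply: sub_sigma_algebra; apply: mball_mopen; have [] := mm_metric X.
Qed.

Section Coupling.
Variables (Y : mmspace) (psi psi' : R -> Y).
Hypotheses (p : parameter psi) (p' : parameter psi').
Notation nu := (@mm_nu Y).
Variable K : nat -> set (mm_meas Y).
Hypothesis mK : forall n, measurable (K n).

Definition below n : set (mm_meas Y) := [set y | exists2 i, (i < n)%N & K i y].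

Lemma below_measurable n : measurable (below n).
Proof.
rewrite (_ : below n = \bigcup_(i < n) K i); first exact: bigcup_measurable.
by apply/seteqP; split=> y [i ? ?]; exists i.
Qed.

(* On each cell of a partition of [Y], the preimages of the cell under both
   parameters are parametrized by one and the same subinterval of [I]. *)
Lemma coupling_below n : forall (Q : set (mm_meas Y)) (a : R), measurable Q ->
  let J := `[a, a + fine (nu Q)[%classic in
  exists (f f' : R -> measurableTypeR R) (G : set R),
    [/\ push J f (lebI (I01 `&` psi @^-1` Q)) /\
        push J f' (lebI (I01 `&` psi' @^-1` Q)),
        forall u, I01 (f u) /\ I01 (f' u),
        [/\ Rborel G, G `<=` J & leb G = nu (Q `&` below n)] &
        forall u, G u -> exists i, K i (psi (f u)) /\ K i (psi' (f' u))].
Proof.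
have P := (parameterP psi).1 p; have P' := (parameterP psi').1 p'.
elim: n => [|n IH] Q a mQ J.
  have [mD eD] := P _ mQ; have [mD' eD'] := P' _ mQ.
  have [f [pf If]] := push_sub_I01 a mD (@subIsetl _ _ _).
  have [f' [pf' If']] := push_sub_I01 a mD' (@subIsetl _ _ _).
  rewrite eD in pf; rewrite eD' in pf'.
  exists f, f', set0; split => //; split => //; first exact: measurable0.
  rewrite /leb (_ : below 0 = set0) ?setI0 ?measure0//.
  by apply/seteqP; split=> // y [].
(* The cell inside [K n] takes the first part of the interval; the rest of [Q] is coupled by
   induction on the adjacent part. *)
pose Q1 := Q `&` K n; pose Q2 := Q `\` K n.
have mQ1 : measurable Q1 by exact: measurableI.
have mQ2 : measurable Q2 by exact: measurableD.
have nuQ A : measurable A -> nu A = (nu (A `&` K n) + nu (A `\` K n))%E.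
  by move=> mA; rewrite addeC; exact: measureDI.
have QE : fine (nu Q) = fine (nu Q1) + fine (nu Q2) by rewrite nuQ.
have [mD1 eD1] := P _ mQ1; have [mD1' eD1'] := P' _ mQ1.
have [f1 [pf1 If1]] := push_sub_I01 a mD1 (@subIsetl _ _ _).
have [f1' [pf1' If1']] := push_sub_I01 a mD1' (@subIsetl _ _ _).
rewrite eD1 in pf1; rewrite eD1' in pf1'.
have [f2 [f2' [G2 [[pf2 pf2'] If2 [mG2 G2J eG2] HG2]]]] := IH Q2 (a + fine (nu Q1)) mQ2.
set J1 := `[a, a + fine (nu Q1)[%classic in pf1 pf1'.
set J2 := `[a + fine (nu Q1), _[%classic in pf2 pf2' G2J.
have mJ1 : Rborel J1 by exact: measurable_itv.
have nu1 : 0 <= fine (nu Q1) by exact: fine_ge0.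
have nu2 : 0 <= fine (nu Q2) by exact: fine_ge0.
have eJ1 : leb J1 = nu Q1 by rewrite leb_itvco ?fineK.
(* Almost every point of [J1] is sent by [f1] into the preimage of [Q1] under [psi], and likewise
   for [f1'] and [psi']. On the intersection of these sets both parameters take values in [K n]. *)
have full g D : push J1 g (lebI D) -> Rborel D -> leb D = nu Q1 ->
    Rborel (J1 `&` g @^-1` D) /\ leb (J1 `&` g @^-1` D) = nu Q1.
  by move=> pg mD eD; have [mgD egD] := pg _ mD; rewrite egD /lebI setIid.
have [mA eA] := full _ _ pf1 mD1 eD1; have [mA' eA'] := full _ _ pf1' mD1' eD1'.
set A := J1 `&` f1 @^-1` _ in mA eA; set A' := J1 `&` f1' @^-1` _ in mA' eA'.
have lebD A0 : A0 `<=` J1 -> Rborel A0 -> leb (J1 `\` A0) = (leb J1 - leb A0)%E.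
  move=> A0J mA0; rewrite /leb measureD//=; last by rewrite [X in (X < _)%E]eJ1 ltry.
  by rewrite setIidr.
have eAA' : leb (A `&` A') = nu Q1.
  rewrite -eA; apply: (@leb_eq_mod_null _ _ (J1 `\` A')) => //.
  - exact: measurableI.
  - exact: measurableD.
  - rewrite lebD//; last by move=> t [].
    by rewrite eJ1 eA' subee.
  - apply/seteqP; split=> t [At nN]; split => //; first by case: At.
    by split => //; apply: contrapT => nA'; apply: nN; split => //; case: At.
have split_leb (h : R -> mm_meas Y) : push I01 h nu -> forall B, Rborel B ->
    lebI (I01 `&` h @^-1` Q) B =
    (lebI (I01 `&` h @^-1` Q1) B + lebI (I01 `&` h @^-1` Q2) B)%E.
  move=> ph B mB; rewrite /lebI /leb -measureU//=.
  - congr lebesgue_measure; rewrite -setIUr -setIUr -preimage_setU.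
    by rewrite setUIDK.
  - by apply: measurableI => //; case: (ph _ mQ1).
  - by apply: measurableI => //; case: (ph _ mQ2).
  - by apply/seteqP; split=> t //= [[_ [_ [_ Kt]]] [_ [_ [_ nKt]]]].
exists (fun t => if t < a + fine (nu Q1) then f1 t else f2 t),
  (fun t => if t < a + fine (nu Q1) then f1' t else f2' t), ((A `&` A') `|` G2).
have J12 t : J1 t -> t < a + fine (nu Q1) by rewrite /J1 /= in_itv /= => /andP[].
have J21 t : J2 t -> (t < a + fine (nu Q1)) = false.
  by rewrite /J2 /= in_itv /= => /andP[]; rewrite leNgt => /negbTE.
split.
- rewrite /J QE; split.
    exact: (push_cat nu1 nu2 pf1 pf2 (split_leb _ P)).
  exact: (push_cat nu1 nu2 pf1' pf2' (split_leb _ P')).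
- by move=> u; have [? ?] := If2 u; case: ifP.
- split.
  + by apply: measurableU => //; exact: measurableI.
  + rewrite /J QE addrA => t [[[+ _] _]|/G2J]; rewrite /J1 /J2 /= !in_itv /= => /andP[t1 t2].
      by rewrite t1 (lt_le_trans t2)// lerDl.
    by rewrite t2 (le_trans _ t1)// lerDl.
  + rewrite /leb measureU//=; last 2 first.
    * exact: measurableI.
    * apply/seteqP; split=> t // -[[[/J12 t1 _] _] /G2J /J21]; by rewrite t1.
    rewrite [X in (X + _)%E]eAA' [X in (_ + X)%E]eG2 -measureU//=.
    * congr mm_nu; apply/seteqP; split=> y.
        case=> [[Qy Ky]|[[Qy _] [i ii Ki]]]; split => //; first by exists n.
        by exists i => //; exact: ltnW.
      move=> [Qy [i]]; rewrite ltnS leq_eqVlt => /orP[/eqP ->|ii] Ki; first by left.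
      by have [Ky|nKy] := pselect (K n y); [left|right; split => //; exists i].
    * by apply: measurableI => //; exact: below_measurable.
    * by apply/seteqP; split=> t //= [[_ Kt] [[_ nKt]]].
- move=> u [[[/J12 u1 [_ [_ Ku]]] [_ [_ [_ Ku']]]]|G2u].
    by exists n; rewrite u1.
  by rewrite (J21 _ (G2J _ G2u)); exact: HG2.
Qed.

End Coupling.

(** Balls of radius [eta / 2] around dense points cover [Y], so finitely many carry mass at least
    [1 - eta]. On the set [G] from [coupling_below] both values lie in a common ball. *)
Lemma coupling (Y : mmspace) (psi psi' : R -> Y) (eta : R) :
  parameter psi -> parameter psi' -> 0 < eta ->
  exists (f f' : R -> R) (G : set R),
    [/\ preserves_leb f, preserves_leb f', Rborel G /\ G `<=` I01,
        ((1 - eta)%:E <= leb G)%E &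
        forall u, G u -> mm_d Y (psi (f u)) (psi' (f' u)) <= eta].
Proof.
move=> p p' eta0.
have [s s_dense] := mm_separable Y.
pose K n : set (mm_meas Y) := mball (mm_d Y) (s n) (eta / 2).
have [_ _ d_sym d_tri] := mm_metric Y.
have mK n : measurable (K n) by exact: mborel_mball.
have KT : \bigcup_n below K n = setT.
  apply/seteqP; split=> // y _; have [n yn] := s_dense y _ (divr_gt0 eta0 (ltr0Sn R 1)).
  by exists n.+1 => //; exists n => //; rewrite /K /mball /= d_sym.
have [n nP] : exists n, ((1 - eta)%:E <= mm_nu (below K n))%E.
  apply: contrapT => /forallNP H.
  have c : (@mm_nu Y \o below K) @ \oo --> mm_nu (\bigcup_n below K n).
    apply: nondecreasing_cvg_mu => [n| |m n mn]; first exact: below_measurable.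
      by apply: bigcupT_measurable => n; exact: below_measurable.
    by apply/subsetPset => y [i im Ki]; exists i => //; exact: leq_trans mn.
  have : (mm_nu (\bigcup_n below K n) <= (1 - eta)%:E)%E.
    apply: cvge_le c; apply: nearW => n /=; rewrite leNgt; apply/negP => /ltW.
    exact: H.
  by rewrite KT mm_nuT lee_fin; lra.
have [f [f' [G [[pf pf'] If [mG GJ eG] HG]]]] := coupling_below p p' mK n 0 measurableT.
rewrite mm_nuT /= add0r !preimage_setT !setIT setTI in pf pf' GJ eG.
exists f, f', G; split => //.
- by split => // u; case: (If u).
- by split => // u; case: (If u).
- by rewrite eG.
- move=> u /HG[i]; rewrite /K /mball /= => -[h1 h2].
  have := d_tri (psi (f u)) (s i) (psi' (f' u)); rewrite (d_sym _ (s i)); lra.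
Qed.

(** * The observable and box distances *)

Lemma leb_mono (A B : set R) : A `<=` B -> (leb A <= leb B)%E.
Proof. by move=> AB; exact: le_outer_measure. Qed.

Lemma leb_U2 (A B : set R) : (leb (A `|` B) <= leb A + leb B)%E.
Proof. exact: outer_measureU2. Qed.

Lemma leb_I01 : leb I01 = 1%E.
Proof. by rewrite (_ : I01 = `[0, 0 + 1[%classic) ?leb_itvco// add0r. Qed.

Lemma leb_I01D (A : set R) : Rborel A -> A `<=` I01 -> leb (I01 `\` A) = (1 - leb A)%E.
Proof.
have mI : Rborel I01 by exact: measurable_itv.
move=> mA AI; rewrite -leb_I01 /leb measureD//=; last first.
  by rewrite [X in (X < _)%E]leb_I01 ltry.
by rewrite setIidr.
Qed.

Lemma parameter_comp (X : mmspace) (phi : R -> X) (a : R -> R) :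
  parameter phi -> preserves_leb a -> parameter (phi \o a).
Proof.
move=> pphi [pa Ia] B mB; have [mD eD] := pphi _ mB; have [mE eE] := pa _ mD.
rewrite (_ : _ `&` _ = I01 `&` a @^-1` (I01 `&` phi @^-1` B)).
  by split => //; rewrite eE /lebI setIC setIA setIid.
by apply/seteqP; split=> t [It Bt]; split=> //; case: Bt.
Qed.

(** These are the values over which [dKF] takes its infimum; estimates are made with this upward
    closed relation instead of the infimum. *)
Definition KF_le (f g : R -> R) (e : R) : Prop :=
  0 <= e /\ (leb (I01 `&` [set s | (e < `|f s - g s|)%R]) <= e%:E)%E.

Lemma KF_le_monotone f g e e' : KF_le f g e -> e <= e' -> KF_le f g e'.
Proof.
move=> [e0 le] ee'; split; first exact: le_trans ee'.
apply: le_trans (leb_mono _) (le_trans le _); last by rewrite lee_fin.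
by move=> t [It /= lt]; split => //; exact: le_lt_trans ee' lt.
Qed.

Lemma KF_le1 f g : KF_le f g 1.
Proof. by split => //; rewrite -leb_I01; apply: leb_mono; exact: subIsetl. Qed.

Lemma KF_le_sym f g e : KF_le f g e -> KF_le g f e.
Proof.
move=> [e0 le]; split => //; apply: le_trans le; apply: leb_mono => t /=.
by rewrite distrC.
Qed.

Lemma KF_le_trans f g h e e' : KF_le f g e -> KF_le g h e' -> KF_le f h (e + e').
Proof.
move=> [e0 le] [e'0 le']; split; first exact: addr_ge0.
apply: le_trans (leb_mono _) (le_trans (leb_U2 _ _) (leeD le le')).
move=> t [It /= H]; have [|h1] := ltP e `|f t - g t|; first by left.
right; split => //=; have := ler_distD (g t) (f t) (h t); lra.
Qed.

(** The functions are arbitrary, so the deviation set may be non-measurable and [leb] is an outer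
    measure on it; a G-delta hull of equal measure is pulled back instead. *)
Lemma KF_le_comp f g e a : KF_le f g e -> preserves_leb a -> KF_le (f \o a) (g \o a) e.
Proof.
move=> [e0 le] [pa Ia]; split => //; apply: le_trans le.
pose D := I01 `&` [set s | (e < `|f s - g s|)%R]; rewrite -/D.
have [G [oG DG eG]] := outer_measure_Gdelta D.
have mG : Rborel (\bigcap_i G i) by apply: bigcapT_measurable => i; exact: open_measurable.
have [_ eH] := pa _ mG.
apply: (@le_trans _ _ (leb (I01 `&` a @^-1` (\bigcap_i G i)))).
  by apply: leb_mono => t [It /= Dt]; split => //; apply: DG; split.
rewrite eH /lebI; apply: (@le_trans _ _ (leb (\bigcap_i G i))).
  by apply: leb_mono; exact: subIsetl.
by rewrite [X in (X <= _)%E]eG.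
Qed.

Lemma dKF_le f g e : KF_le f g e -> dKF f g <= e.
Proof. by move=> H; apply: ge_inf => //; exists 0 => x []. Qed.

Lemma dKF_lt f g e : dKF f g < e -> KF_le f g e.
Proof.
move=> /inf_lt[|x Hx /ltW]; first by exists 1; exact: KF_le1.
exact: KF_le_monotone Hx.
Qed.

Lemma le_dKF f g e : (forall x, KF_le f g x -> e <= x) -> e <= dKF f g.
Proof. by move=> H; apply: lb_le_inf => //; exists 1; exact: KF_le1. Qed.

Lemma dKF_ge0 f g : 0 <= dKF f g.
Proof. by apply: le_dKF => x []. Qed.

(** The neighborhood form of the Hausdorff distance: for nonempty families it gives
    [hausdorff_KF A B <= e], and it follows from [hausdorff_KF A B < e]. *)
Definition KF_near (A B : set (R -> R)) (e : R) : Prop :=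
  (forall a, A a -> exists2 b, B b & KF_le a b e) /\
  (forall b, B b -> exists2 a, A a & KF_le a b e).

Lemma KF_near_sym A B e : KF_near A B e -> KF_near B A e.
Proof.
by move=> [AB BA]; split=> [b /BA|a /AB] [c ? /KF_le_sym ?]; exists c.
Qed.

Lemma KF_near_trans A B C e e' : KF_near A B e -> KF_near B C e' -> KF_near A C (e + e').
Proof.
move=> [AB BA] [BC CB]; split=> [a /AB[b /BC[c Cc bc] ab]|c /CB[b /BA[a Aa ab] bc]].
  by exists c => //; exact: KF_le_trans ab bc.
by exists a => //; exact: KF_le_trans ab bc.
Qed.

Section Hausdorff.
Variables A B : set (R -> R).
Hypotheses (A0 : A !=set0) (B0 : B !=set0).

Let infB a := inf [set dKF a b | b in B].
Let infA b := inf [set dKF a b | a in A].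

Let infB_lt a e : infB a < e -> exists2 b, B b & KF_le a b e.
Proof.
move=> /inf_lt[|_ [b Bb <-] /dKF_lt]; last by exists b.
by have [b Bb] := B0; exists (dKF a b), b.
Qed.

Let infA_lt b e : infA b < e -> exists2 a, A a & KF_le a b e.
Proof.
move=> /inf_lt[|_ [a Aa <-] /dKF_lt]; last by exists a.
by have [a Aa] := A0; exists (dKF a b), a.
Qed.

Let infB_le a b e : B b -> KF_le a b e -> infB a <= e.
Proof.
move=> Bb /dKF_le; apply: le_trans; apply: ge_inf; last by exists b.
by exists 0 => _ [c _ <-]; exact: dKF_ge0.
Qed.

Let infA_le a b e : A a -> KF_le a b e -> infA b <= e.
Proof.
move=> Aa /dKF_le; apply: le_trans; apply: ge_inf; last by exists a.
by exists 0 => _ [c _ <-]; exact: dKF_ge0.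
Qed.

Lemma hausdorff_KF_le e : KF_near A B e -> hausdorff_KF A B <= e.
Proof.
move=> [AB BA]; rewrite /hausdorff_KF ge_max; apply/andP; split.
  apply: ge_sup; first by have [a Aa] := A0; exists (infB a), a.
  by move=> _ [a Aa <-]; have [b Bb ab] := AB _ Aa; exact: infB_le ab.
apply: ge_sup; first by have [b Bb] := B0; exists (infA b), b.
by move=> _ [b Bb <-]; have [a Aa ab] := BA _ Bb; exact: infA_le ab.
Qed.

Let le_hausdorff_l a : A a -> infB a <= hausdorff_KF A B.
Proof.
move=> Aa; rewrite /hausdorff_KF le_max; apply/orP; left.
apply: ub_le_sup; last by exists a.
(* Ky Fan distances never exceed [1], so the supremum is taken over a bounded set and is not a
   default value. *)
exists 1 => _ [c Ac <-]; have [b Bb] := B0; exact: infB_le (KF_le1 c b).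
Qed.

Let le_hausdorff_r b : B b -> infA b <= hausdorff_KF A B.
Proof.
move=> Bb; rewrite /hausdorff_KF le_max; apply/orP; right.
apply: ub_le_sup; last by exists b.
exists 1 => _ [c Ac <-]; have [a Aa] := A0; exact: infA_le (KF_le1 a c).
Qed.

Lemma hausdorff_KF_lt e : hausdorff_KF A B < e -> KF_near A B e.
Proof.
move=> He; split=> [a|b] H.
  exact: infB_lt (le_lt_trans (le_hausdorff_l H) He).
exact: infA_lt (le_lt_trans (le_hausdorff_r H) He).
Qed.

Lemma hausdorff_KF_ge0 : 0 <= hausdorff_KF A B.
Proof.
have [a Aa] := A0; apply: le_trans (le_hausdorff_l Aa).
apply: lb_le_inf; first by have [b Bb] := B0; exists (dKF a b), b.
by move=> _ [b _ <-]; exact: dKF_ge0.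
Qed.

End Hausdorff.

(** * The observable distance as a pseudometric *)

Lemma obs_neq0 (X : mmspace) (phi : R -> X) : obs phi !=set0.
Proof.
exists ((fun=> 0) \o phi), (fun=> 0) => // x y.
by rewrite subrr normr0 metric_ge0//; exact: mm_metric.
Qed.

Definition conc_le (X Y : mmspace) (e : R) : Prop :=
  exists (phi : R -> X) (psi : R -> Y),
    [/\ parameter phi, parameter psi & KF_near (obs phi) (obs psi) e].

Lemma conc_dist_le X Y e : conc_le X Y e -> conc_dist X Y <= e.
Proof.
move=> [phi [psi [p q H]]].
apply: le_trans (hausdorff_KF_le (obs_neq0 _) (obs_neq0 _) H).
apply: ge_inf; last by exists phi, psi.
by exists 0 => _ [f [g [_ _ ->]]]; apply: hausdorff_KF_ge0; exact: obs_neq0.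
Qed.

Lemma conc_dist_lt X Y e : conc_dist X Y < e -> conc_le X Y e.
Proof.
move=> /inf_lt[|_ [phi [psi [p q ->]]]].
  have [phi p] := parameter_exists X; have [psi q] := parameter_exists Y.
  by exists (hausdorff_KF (obs phi) (obs psi)), phi, psi.
by move=> /(hausdorff_KF_lt (obs_neq0 _) (obs_neq0 _)) H; exists phi, psi.
Qed.

Lemma conc_le_sym X Y e : conc_le X Y e -> conc_le Y X e.
Proof. by move=> [f [g [p q /KF_near_sym H]]]; exists g, f. Qed.

Lemma obs_comp (X Y : mmspace) (phi : R -> X) (psi : R -> Y) a e : preserves_leb a ->
  KF_near (obs phi) (obs psi) e -> KF_near (obs (phi \o a)) (obs (psi \o a)) e.
Proof.
move=> pa [H1 H2]; split=> _ [f lf <-].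
  have [|_ [g lg <-] fg] := H1 (f \o phi); first by exists f.
  by exists (g \o (psi \o a)); [exists g|exact: KF_le_comp fg pa].
have [|_ [g lg <-] fg] := H2 (f \o psi); first by exists f.
by exists (g \o (phi \o a)); [exists g|exact: KF_le_comp fg pa].
Qed.

(** The same 1-Lipschitz [f] serves on both sides: its two compositions differ by at most [e] on
    [G], whose complement has measure at most [e]. *)
Lemma obs_near (Y : mmspace) (psi psi' : R -> Y) (G : set R) (e : R) :
  Rborel G -> G `<=` I01 -> ((1 - e)%:E <= leb G)%E -> 0 <= e ->
  (forall u, G u -> mm_d Y (psi u) (psi' u) <= e) ->
  KF_near (obs psi) (obs psi') e.
Proof.
move=> mG GI eG e0 H.
have K f : @lip1 Y f -> KF_le (f \o psi) (f \o psi') e.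
  move=> lf; split => //; apply: (@le_trans _ _ (leb (I01 `\` G))).
    apply: leb_mono => t [It /= et]; split => // /H /(le_trans (lf _ _)).
    by rewrite leNgt et.
  rewrite leb_I01D//; move: eG.
  rewrite -(fineK (leb_fin_itv mG (GI : G `<=` `[0, 1[%classic))) -EFinB !lee_fin; lra.
by split=> _ [f lf <-]; [exists (f \o psi')|exists (f \o psi)]; try exact: K; exists f.
Qed.

(** The two comparisons see [Y] through different parameters [psi] and [psi']. Coupling these costs
    [eta], and composing with measure-preserving maps spoils neither comparison. *)
Lemma conc_le_trans X Y Z e e' eta : 0 < eta ->
  conc_le X Y e -> conc_le Y Z e' -> conc_le X Z (e + eta + e').
Proof.
move=> eta0 [phi [psi [p q H]]] [psi' [chi [q' r H']]].
have [a [b [G [pa pb [mG GI] eG HG]]]] := coupling q q' eta0.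
exists (phi \o a), (chi \o b); split; try exact: parameter_comp.
apply: KF_near_trans (obs_comp pb H'); apply: KF_near_trans (obs_comp pa H) _.
exact: (obs_near mG GI eG (ltW eta0)).
Qed.

Lemma conc_triangle X Y Z : conc_dist X Z <= conc_dist X Y + conc_dist Y Z.
Proof.
apply/ler_addgt0Pr => e e0.
have e3 : 0 < e / 3 by lra.
have XY : conc_le X Y (conc_dist X Y + e / 3) by apply: conc_dist_lt; rewrite ltrDl.
have YZ : conc_le Y Z (conc_dist Y Z + e / 3) by apply: conc_dist_lt; rewrite ltrDl.
have := conc_dist_le (conc_le_trans e3 XY YZ); lra.
Qed.

Lemma conc_sym X Y : conc_dist X Y = conc_dist Y X.
Proof.
suff H A B : conc_dist A B <= conc_dist B A by apply/eqP; rewrite eq_le !H.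
apply/ler_addgt0Pr => e e0; apply: conc_dist_le; apply: conc_le_sym.
by apply: conc_dist_lt; rewrite ltrDl.
Qed.

Lemma conc_ge0 X Y : 0 <= conc_dist X Y.
Proof.
apply: lb_le_inf.
  have [phi p] := parameter_exists X; have [psi q] := parameter_exists Y.
  by exists (hausdorff_KF (obs phi) (obs psi)), phi, psi.
by move=> _ [f [g [_ _ ->]]]; apply: hausdorff_KF_ge0; exact: obs_neq0.
Qed.

(** * The box distance as a pseudometric *)

Definition box_le (X Y : mmspace) (e : R) : Prop :=
  0 <= e /\
  exists (phi : R -> X) (psi : R -> Y) (I0 : set R),
    [/\ parameter phi, parameter psi, Rborel I0, I0 `<=` I01 &
      ((1 - e)%R%:E <= leb I0)%E /\
      forall s t, I0 s -> I0 t ->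
        `|mm_d X (phi s) (phi t) - mm_d Y (psi s) (psi t)| <= e].

Lemma box_dist_le X Y e : box_le X Y e -> box_dist X Y <= e.
Proof. by move=> H; apply: ge_inf => //; exists 0 => x []. Qed.

Lemma box_le1 X Y : box_le X Y 1.
Proof.
split => //; have [phi p] := parameter_exists X; have [psi q] := parameter_exists Y.
exists phi, psi, set0; split => //; first exact: measurable0.
by rewrite subrr /leb measure0.
Qed.

Lemma box_dist_lt X Y e : box_dist X Y < e -> exists2 e', box_le X Y e' & e' < e.
Proof. by move=> /inf_lt; apply; exists 1; exact: box_le1. Qed.

Lemma box_ge0 X Y : 0 <= box_dist X Y.
Proof. by apply: lb_le_inf; [exists 1; exact: box_le1|move=> x []]. Qed.

Lemma box_le_sym X Y e : box_le X Y e -> box_le Y X e.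
Proof.
move=> [e0 [f [g [G [p q mG GI [eG HG]]]]]]; split => //; exists g, f, G; split => //.
by split => // s t Gs Gt; rewrite distrC; exact: HG.
Qed.

Lemma box_sym X Y : box_dist X Y = box_dist Y X.
Proof.
by congr inf; apply/seteqP; split=> e; exact: box_le_sym.
Qed.

(** On the intersection of [G] with the pulled-back good sets, passing from [psi] to [psi'] moves
    each of two endpoints by at most [eta], whence [2 * eta]; the mass lost is at most
    [e + e' + eta]. *)
Lemma box_le_trans X Y Z e e' eta : 0 < eta ->
  box_le X Y e -> box_le Y Z e' -> box_le X Z (e + e' + 2 * eta).
Proof.
move=> eta0 [e0 [phi [psi [A [p q mA AI [eA HA]]]]]].
move=> [e'0 [psi' [chi [B [q' r mB BI [eB HB]]]]]].
have [a [b [G [pa pb [mG GI] eG HG]]]] := coupling q q' eta0.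
split; first lra.
have pre c (C : set R) : preserves_leb c -> Rborel C -> C `<=` I01 ->
    Rborel (I01 `&` c @^-1` C) /\ leb (I01 `&` c @^-1` C) = leb C.
  by move=> [pc _] mC CI; have [mE eE] := pc _ mC; split => //; rewrite eE /lebI (setIidl CI).
have [mA' eA'] := pre _ _ pa mA AI; have [mB' eB'] := pre _ _ pb mB BI.
set A' := _ `&` _ in mA' eA'; set B' := _ `&` _ in mB' eB'.
exists (phi \o a), (chi \o b), (A' `&` B' `&` G).
have mABG : Rborel (A' `&` B' `&` G) by do 2 apply: measurableI => //.
have IABG : A' `&` B' `&` G `<=` I01 by move=> t [_ /GI].
split => //; try exact: parameter_comp.
split.
  have fin C : Rborel C -> C `<=` I01 -> leb C = (fine (leb C))%:E.
    by move=> mC CI; rewrite fineK// (@leb_fin_itv 0 1).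
  have cpl C : Rborel C -> C `<=` I01 -> leb (I01 `\` C) = (1 - fine (leb C))%:E.
    by move=> mC CI; rewrite leb_I01D// {1}(fin C).
  have AI' : A' `<=` I01 by move=> t [].
  have BI' : B' `<=` I01 by move=> t [].
  have : (leb (I01 `\` (A' `&` B' `&` G)) <=
      leb (I01 `\` A') + leb (I01 `\` B') + leb (I01 `\` G))%E.
    rewrite setDIr setDIr; apply: le_trans (leb_U2 _ _) _.
    by apply: leeD => //; exact: leb_U2.
  rewrite !cpl// -!EFinD lee_fin.
  rewrite eA' eB'.
  move: eA eB eG; rewrite (fin A)// (fin B)// (fin G)// (fin (A' `&` B' `&` G))//.
  rewrite !lee_fin /=; lra.
move=> s t [[[Is As] [_ Bs]] Gs] [[[It At] [_ Bt]] Gt] /=.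
have := HA _ _ As At; have := HB _ _ Bs Bt; have := HG _ Gs; have := HG _ Gt.
have [_ _ d_sym d_tri] := mm_metric Y.
set x := psi (a s); set y := psi (a t); set x' := psi' (b s); set y' := psi' (b t).
have := d_tri x x' y; have := d_tri x' y' y; rewrite (d_sym y' y).
have := d_tri x' x y'; have := d_tri x y y'; rewrite (d_sym x' x).
rewrite !ler_norml => ? ? ? ? ? ? /andP[? ?] /andP[? ?].
by apply/andP; split; lra.
Qed.

Lemma box_triangle X Y Z : box_dist X Z <= box_dist X Y + box_dist Y Z.
Proof.
apply/ler_addgt0Pr => e e0.
(* One quarter goes to each comparison and two to the term [2 * eta]. *)
have e4 : 0 < e / 4 by lra.
have [|u XY u1] := @box_dist_lt X Y (box_dist X Y + e / 4); first by rewrite ltrDl.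
have [|v YZ v1] := @box_dist_lt Y Z (box_dist Y Z + e / 4); first by rewrite ltrDl.
have := box_dist_le (box_le_trans e4 XY YZ); lra.
Qed.

(* McShane extension of the values [f (phi s)] prescribed at [psi s]. *)
Lemma lip1_transfer (X Y : mmspace) (phi : R -> X) (psi : R -> Y) (S : set R)
    (e : R) (f : X -> R) :
  (forall s t, S s -> S t ->
    `|mm_d X (phi s) (phi t) - mm_d Y (psi s) (psi t)| <= e) ->
  lip1 f -> exists2 g : Y -> R, lip1 g & forall t, S t -> `|f (phi t) - g (psi t)| <= e.
Proof.
move=> H lf; have [[s0 Ss0]|S0] := pselect (S !=set0); last first.
  exists (fun=> 0) => [x y|t St]; last by case: S0; exists t.
  by rewrite subrr normr0; apply: metric_ge0; exact: mm_metric.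
have mY := mm_metric Y; have [d0 _ d_sym d_tri] := mY.
pose V y := [set f (phi s) + mm_d Y y (psi s) | s in S].
have V0 y : V y !=set0 by exists (f (phi s0) + mm_d Y y (psi s0)), s0.
(* This bounds [V y] from below, so that its infimum is genuine, and at [y = psi t] it gives one
   half of the final estimate. *)
have lV s t y : S s -> S t ->
    f (phi t) - mm_d Y (psi t) y - e <= f (phi s) + mm_d Y y (psi s).
  move=> Ss St; have := H _ _ Ss St; have := lf (phi s) (phi t).
  have := d_tri (psi s) y (psi t); rewrite (d_sym (psi s) y) (d_sym y (psi t)).
  by rewrite !ler_norml => ? /andP[? ?] /andP[? ?]; lra.
have hV y : has_lbound (V y).
  by exists (f (phi s0) - mm_d Y (psi s0) y - e) => _ [s Ss <-]; exact: lV.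
have half y y' : inf (V y) - inf (V y') <= mm_d Y y y'.
  rewrite lerBlDr addrC -lerBlDr; apply: lb_le_inf => // _ [s Ss <-].
  rewrite lerBlDr; apply: (@le_trans _ _ (f (phi s) + mm_d Y y (psi s))).
    by apply: ge_inf => //; exists s.
  by rewrite -addrA lerD2l addrC.
exists (fun y => inf (V y)) => [y y'|t St].
  by rewrite ler_norml lerNl opprB half d_sym half.
rewrite ler_norml; apply/andP; split.
  rewrite lerBrDl -lerBrDr opprK.
  apply: le_trans (_ : f (phi t) + mm_d Y (psi t) (psi t) <= _); last first.
    by rewrite d0 addr0 lerDl; have := H _ _ St St; exact: le_trans.
  by apply: ge_inf => //; exists t.
rewrite lerBlDr addrC -lerBlDr; apply: lb_le_inf => // _ [s Ss <-].
by have := lV s t (psi t) Ss St; rewrite d0 subr0.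
Qed.

(** * Scaling and measure-preserving maps *)

(** With the same parameters, [lip1_transfer] carries each 1-Lipschitz function across with error
    [u] on [G], and the complement of [G] has measure at most [u]. *)
Lemma conc_le_box X Y : conc_dist X Y <= box_dist X Y.
Proof.
apply/ler_addgt0Pr => e e0.
have [|u [u0 [phi [psi [G [p q mG GI [eG HG]]]]]] ue] := @box_dist_lt X Y (box_dist X Y + e).
  by rewrite ltrDl.
apply: le_trans (ltW ue); apply: conc_dist_le; exists phi, psi; split => //.
have K f g : (forall t, G t -> `|f t - g t| <= u) -> KF_le f g u.
  move=> H; split => //; apply: (@le_trans _ _ (leb (I01 `\` G))).
    by apply: leb_mono => t [It /= et]; split => // /H; rewrite leNgt et.
  rewrite leb_I01D//; move: eG.
  rewrite -(fineK (leb_fin_itv mG (GI : G `<=` `[0, 1[%classic))) -EFinB !lee_fin; lra.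
split=> _ [f lf <-].
  have [g lg Hg] := lip1_transfer HG lf.
  by exists (g \o psi); [exists g|exact: K].
have HG' s t : G s -> G t ->
    `|mm_d Y (psi s) (psi t) - mm_d X (phi s) (phi t)| <= u.
  by move=> Gs Gt; rewrite distrC; exact: HG.
have [g lg Hg] := lip1_transfer HG' lf.
exists (g \o phi); first by exists g.
by apply: K => t Gt; rewrite /= distrC; exact: Hg.
Qed.

Lemma mborel_preimage (X Y : mmspace) (f : X -> Y) :
  (forall U, mopen (mm_d Y) U -> mopen (mm_d X) (f @^-1` U)) ->
  forall B, mborel (mm_d Y) B -> mborel (mm_d X) (f @^-1` B).
Proof.
move=> cf B mB.
have mf : measurable_fun setT (f : mm_meas X -> mm_meas Y).
  apply: (@measurability _ _ (mm_meas X) (mm_meas Y) setT f (mopen (mm_d Y)) erefl) => _ [U oU <-].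
  by rewrite setTI; apply: sub_sigma_algebra; exact: cf.
by have := mf measurableT B mB; rewrite setTI.
Qed.

Lemma mopen_scale (T : Type) (d : T -> T -> R) (t : R) : 0 < t ->
  mopen (fun x y => t * d x y) = mopen d.
Proof.
move=> t0; apply/seteqP; split=> U oU x /oU[r [r0 rU]].
  exists (r / t); split; first exact: divr_gt0.
  by move=> y; rewrite /mball /= ltr_pdivlMr// mulrC => /rU.
exists (t * r); split; first exact: mulr_gt0.
by move=> y; rewrite /mball /= ltr_pM2l// => /rU.
Qed.

Section Scale.
Variables (t : R) (t0 : 0 < t) (X : mmspace).

Let sd (x y : X) := t * mm_d X x y.

Let sd_metric : is_metric sd.
Proof.
have [d0 d_eq d_sym d_tri] := mm_metric X; split; rewrite /sd.
- by move=> x; rewrite d0 mulr0.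
- by move=> x y /eqP; rewrite mulf_eq0 gt_eqF//= => /eqP /d_eq.
- by move=> x y; rewrite d_sym.
- by move=> x y z; rewrite -mulrDr ler_pM2l.
Qed.

Let sd_complete : complete_metric sd.
Proof.
move=> u Hu; have [e e0|x Hx] := @mm_complete X u.
  have [N NP] := Hu _ (mulr_gt0 t0 e0); exists N => m n Nm Nn.
  by have := NP _ _ Nm Nn; rewrite /sd ltr_pM2l.
exists x => e e0; have [N NP] := Hx _ (divr_gt0 e0 t0); exists N => n /NP.
by rewrite /sd ltr_pdivlMr// mulrC.
Qed.

Let sd_separable : separable_metric sd.
Proof.
have [s sP] := mm_separable X; exists s => x e e0.
have [n] := sP x _ (divr_gt0 e0 t0); exists n.
by rewrite /sd -ltr_pdivlMl// mulrC.
Qed.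

Let sd_prob : borel_probability sd (mm_mu X).
Proof. by have := mm_prob X; rewrite /borel_probability /mborel mopen_scale. Qed.

Let sd_supp : full_support sd (mm_mu X).
Proof.
move=> x r r0; have := @mm_supp X x _ (divr_gt0 r0 t0); congr (0 < mm_mu X _).
by apply/seteqP; split=> y; rewrite /mball /= /sd ltr_pdivlMr// mulrC.
Qed.

Definition scale : mmspace :=
  MMSpace sd_metric sd_complete sd_separable sd_prob sd_supp.

Lemma mborel_scale : mborel (mm_d scale) = mborel (mm_d X).
Proof. by rewrite /mborel mopen_scale. Qed.

Lemma parameter_scale (phi : R -> X) :
  parameter phi -> parameter (phi : R -> scale).
Proof. by rewrite /parameter mborel_scale. Qed.

End Scale.

Lemma le_of_scaled_bounds (M a b : R) : 0 < M ->
  (forall e, a < e -> b <= M * e) -> b <= M * a.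
Proof.
move=> M0 H; rewrite mulrC -ler_pdivrMr//; apply/ler_addgt0Pr => e e0.
by rewrite ler_pdivrMr// mulrC; apply: H; rewrite ltrDl.
Qed.

(** The distortion is multiplied by [t] but the discarded mass is not, hence the factor
    [max 1 t]. *)
Lemma box_scale t (t0 : 0 < t) X Y :
  box_dist (scale t0 X) (scale t0 Y) <= Num.max 1 t * box_dist X Y.
Proof.
have M1 : 1 <= Num.max 1 t by rewrite le_max lexx.
have Mt : t <= Num.max 1 t by rewrite le_max lexx orbT.
have M0 : 0 < Num.max 1 t by exact: lt_le_trans M1.
apply: le_of_scaled_bounds => // e /box_dist_lt[u [u0 [f [g [G [p q mG GI [eG HG]]]]]] ue].
apply: (@le_trans _ _ (Num.max 1 t * u)); last by rewrite ler_pM2l// ltW.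
apply: box_dist_le; split; first by rewrite mulr_ge0// ltW.
exists f, g, G; split => //; try exact: parameter_scale.
split.
  apply: le_trans eG; rewrite lee_fin lerD2l lerN2.
  by rewrite -[X in X <= _]mul1r ler_wpM2r.
move=> x y Gx Gy /=; rewrite -mulrBr normrM gtr0_norm//.
by apply: ler_pM => //; [exact: ltW|exact: HG].
Qed.

(** The 1-Lipschitz functions of the scaled space are [t] times those of the original; deviations
    scale by [t], their measure does not. *)
Lemma conc_scale t (t0 : 0 < t) X Y :
  conc_dist (scale t0 X) (scale t0 Y) <= Num.max 1 t * conc_dist X Y.
Proof.
have M1 : 1 <= Num.max 1 t by rewrite le_max lexx.
have Mt : t <= Num.max 1 t by rewrite le_max lexx orbT.
have M0 : 0 < Num.max 1 t by exact: lt_le_trans M1.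
apply: le_of_scaled_bounds => // e /conc_dist_lt[phi [psi [p q [H1 H2]]]].
apply: conc_dist_le; exists phi, psi; split; try exact: parameter_scale.
have K f g : KF_le (fun s => t^-1 * f s) g e -> KF_le f (fun s => t * g s) (Num.max 1 t * e).
  move=> [e0 le]; split; first by rewrite mulr_ge0// ltW.
  apply: le_trans (leb_mono _) (le_trans le _); last first.
    by rewrite lee_fin -[X in X <= _]mul1r ler_wpM2r.
  move=> s [Is /= lt]; split => //=.
  have -> : t^-1 * f s - g s = t^-1 * (f s - t * g s) by field; rewrite gt_eqF.
  rewrite normrM gtr0_norm ?invr_gt0// ltr_pdivlMl//.
  by apply: le_lt_trans lt; rewrite ler_wpM2r.
have L Z f : @lip1 (scale t0 Z) f -> @lip1 Z (fun z => t^-1 * f z).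
  move=> lf x y; rewrite -mulrBr normrM gtr0_norm ?invr_gt0//.
  by rewrite ler_pdivrMl//; exact: lf.
have L' Z f : @lip1 Z f -> @lip1 (scale t0 Z) (fun z => t * f z).
  move=> lf x y; rewrite -mulrBr normrM gtr0_norm//=.
  by rewrite ler_pM2l//; exact: lf.
split=> _ [f lf <-].
  have [|_ [g lg <-] fg] := H1 ((fun z => t^-1 * f z) \o phi).
    by exists (fun z => t^-1 * f z) => //; exact: L.
  exists ((fun z => t * g z) \o psi); last exact: K.
  by exists (fun z => t * g z) => //; exact: L'.
have [|_ [g lg <-] /KF_le_sym fg] := H2 ((fun z => t^-1 * f z) \o psi).
  by exists (fun z => t^-1 * f z) => //; exact: L.
exists ((fun z => t * g z) \o phi); last exact/KF_le_sym/K.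
by exists (fun z => t * g z) => //; exact: L'.
Qed.

(** Composition with [h] turns a parameter of [Y] into one of [X], and the preimage of [Y0] serves
    as [I0]. *)
Lemma box_map (Y X : mmspace) (h : Y -> X) (Y0 : set Y) (e : R) : 0 <= e ->
  (forall B, mborel (mm_d X) B ->
    mborel (mm_d Y) (h @^-1` B) /\ mm_mu Y (h @^-1` B) = mm_mu X B) ->
  mborel (mm_d Y) Y0 -> 1 - e <= mm_mu Y Y0 ->
  (forall y y', Y0 y -> Y0 y' -> `|mm_d Y y y' - mm_d X (h y) (h y')| <= e) ->
  box_dist Y X <= e.
Proof.
move=> e0 Hh mY0 eY0 H; apply: box_dist_le; split => //.
have [phi p] := parameter_exists Y; have [mG eG] := p _ mY0.
exists phi, (h \o phi), (I01 `&` phi @^-1` Y0); split => //.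
- by move=> B /Hh[mB <-]; exact: p.
- split; first by rewrite eG lee_fin.
  by move=> s t [_ Ys] [_ Yt]; exact: H.
Qed.

Lemma mm_iso_scaled_mborel t (X Y : mmspace) (f : X -> Y) : 0 < t ->
  (forall x y, mm_d Y (f x) (f y) = t * mm_d X x y) ->
  forall B, mborel (mm_d Y) B -> mborel (mm_d X) (f @^-1` B).
Proof.
move=> t0 H; apply: mborel_preimage => U oU x /oU[r [r0 rU]].
exists (r / t); split; first exact: divr_gt0.
by move=> y; rewrite /mball /= ltr_pdivlMr// mulrC -H => /rU.
Qed.

Lemma box_mm_iso X Y : mm_iso X Y -> box_dist X Y = 0.
Proof.
move=> [f [df mf]]; apply/eqP; rewrite eq_le box_ge0 andbT.
apply: (@box_map _ _ f setT) => //.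
- by move=> B mB; split; [exact: (mm_iso_scaled_mborel ltr01 df)|exact: mf].
- exact: (@measurableT _ (mm_meas X)).
- by have [_ _ _ ->] := mm_prob X; rewrite subr0.
- by move=> x y _ _; rewrite df mul1r subrr normr0.
Qed.

Lemma mm_iso_refl X : mm_iso X X.
Proof. by exists id; split => // x y; rewrite mul1r. Qed.

Lemma mm_iso_scaled_trans s t X Y Z : 0 < t ->
  mm_iso_scaled s X Y -> mm_iso_scaled t Y Z -> mm_iso_scaled (t * s) X Z.
Proof.
move=> t0 [f [df mf]] [g [dg mg]]; exists (g \o f); split.
  by move=> x y /=; rewrite dg df mulrA.
move=> B mB; rewrite -mg// -mf//; exact: (mm_iso_scaled_mborel t0 dg).
Qed.

Lemma mm_iso_scale_orbit s t (s0 : 0 < s) (t0 : 0 < t) (st0 : 0 < t / s) X Y :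
  mm_iso_scaled s X Y -> mm_iso (scale t0 X) (scale st0 Y).
Proof.
move=> [f [df mf]]; exists f; split=> [x y /=|B].
  by rewrite df mul1r; field; rewrite gt_eqF.
by rewrite mborel_scale; exact: mf.
Qed.

(** * Finite spaces *)

Section FiniteSpace.
Variables (T : Type) (n : nat) (p : nat -> T) (d : T -> T -> R) (w : T -> R) (r : R).
Hypotheses (p_surj : forall x, exists2 i, (i < n)%N & p i = x)
  (r0 : 0 < r) (dxx : forall x, d x x = 0)
  (d_ge : forall x y, x <> y -> r <= d x y)
  (d_sym : forall x y, d x y = d y x)
  (d_tri : forall x y z, d x z <= d x y + d y z)
  (w0 : forall x, 0 < w x) (w1 : \sum_(i < n) w (p i) = 1).

Definition weight (A : set T) : R := \sum_(i < n) (if `[< A (p i) >] then w (p i) else 0).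

Let d_lt x y : d x y < r -> x = y.
Proof. by move=> xy; apply: contrapT => /d_ge; rewrite leNgt xy. Qed.

Lemma finite_mopen (U : set T) : mopen d U.
Proof. by move=> x Ux; exists r; split => // y /d_lt <-. Qed.

Let fin_metric : is_metric d.
Proof. by split => // x y xy; apply: d_lt; rewrite xy. Qed.

Let fin_complete : complete_metric d.
Proof.
move=> u /(_ _ r0)[N NP]; exists (u N) => e e0; exists N => m Nm.
by rewrite (d_lt (NP _ _ Nm (leqnn N))) dxx.
Qed.

Let fin_separable : separable_metric d.
Proof. by exists p => x e e0; have [i _ <-] := p_surj x; exists i; rewrite dxx. Qed.

Let fin_prob : borel_probability d weight.
Proof.
split.
- by apply: big1 => i _; rewrite asboolF.
- by move=> A _; apply: sumr_ge0 => i _; case: ifP => // _; exact: ltW.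
- move=> F _ tF.
  (* By disjointness [p i] lies in at most one [F k], so its contribution is eventually constant;
     the convergence is then that of an eventually constant sequence. *)
  have H (i : 'I_n) : exists N, forall m, (N <= m)%N ->
      \sum_(k < m) (if `[< F k (p i) >] then w (p i) else 0) =
      (if `[< (\bigcup_k F k) (p i) >] then w (p i) else 0).
    have [[k _ Fk]|nF] := pselect ((\bigcup_k F k) (p i)); last first.
      exists 0%N => m _; rewrite [in RHS]asboolF// big1// => k _.
      by rewrite asboolF// => Fk; apply: nF; exists k.
    exists k.+1 => m km; rewrite [in RHS]asboolT; last by exists k.
    rewrite (bigD1 (Ordinal km))//= asboolT// big1 ?addr0// => j jk.
    rewrite asboolF// => Fj; move/eqP: jk; apply; apply: val_inj => /=.
    by apply: (tF j k) => //; exists (p i).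
  have /choice[N NP] := H.
  apply: cvg_near_cst; exists (\max_i N i)%N => // m /= Nm.
  rewrite /weight exchange_big /=; apply: eq_bigr => i _.
  by apply: NP; apply: leq_trans Nm; exact: leq_bigmax.
- by rewrite -w1; apply: eq_bigr => i _; rewrite asboolT.
Qed.

Let fin_supp : full_support d weight.
Proof.
move=> x e e0; have [i i_n pix] := p_surj x.
rewrite /weight (bigD1 (Ordinal i_n))//= asboolT; last by rewrite /mball /= pix dxx.
by rewrite ltr_pwDl// sumr_ge0// => j _; case: ifP => // _; exact: ltW.
Qed.

Definition finite_space : mmspace :=
  MMSpace fin_metric fin_complete fin_separable fin_prob fin_supp.

Lemma finite_mborel (A : set finite_space) : mborel (mm_d finite_space) A.
Proof. by apply: sub_sigma_algebra; exact: finite_mopen. Qed.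

End FiniteSpace.

Definition point : mmspace.
Proof.
apply: (@finite_space unit 1 (fun=> tt) (fun _ _ => 0) (fun=> 1) 1) => //.
- by case; exists 0%N.
- by move=> [] [].
- by rewrite big_ord1.
Defined.

Definition two_dist (x y : bool) : R := (x != y)%:R.

Definition two_space (e : R) : 0 < e < 1 -> mmspace.
Proof.
move=> e01.
apply: (@finite_space bool 2 (fun i => if i is 0%N then true else false)
  two_dist (fun b => if b then 1 - e else e) 1) => //.
- by case; [exists 0%N|exists 1%N].
- by move=> x; rewrite /two_dist eqxx.
- by move=> x y /eqP; rewrite /two_dist => ->.
- by move=> x y; rewrite /two_dist eq_sym.
- by move=> [] [] []; rewrite /two_dist /=; lra.
- by case; move: e01 => /andP[]; lra.
- by rewrite big_ord_recl big_ord1 /=; lra.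
Defined.

(** Options coerce to booleans through [isSome], so [x && y] means that neither point is [None];
    [None] is the far point. *)
Definition three_dist (L : R) (x y : option bool) : R :=
  if x == y then 0 else if x && y then 1 else L.

(** The far point takes its mass from [Some true], so merging these two gives masses [1/2] and
    [1/2]. *)
Definition three_weight (e : R) (x : option bool) : R :=
  match x with None => e | Some true => 2^-1 - e | Some false => 2^-1 end.

Definition three_space (e L : R) : 0 < e < 2^-1 -> 1 <= L -> mmspace.
Proof.
move=> e0 L1.
apply: (@finite_space (option bool) 3
  (fun i => match i with 0%N => None | 1%N => Some true | _ => Some false end)
  (three_dist L) (three_weight e) 1) => //.
- by case=> [[]|]; [exists 1%N|exists 2%N|exists 0%N].
- by move=> x; rewrite /three_dist eqxx.
- by move=> x y /eqP/negbTE; rewrite /three_dist => ->; case: ifP.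
- by move=> x y; rewrite /three_dist eq_sym; case: x y => [[]|] [[]|].
- by move=> [[]|] [[]|] [[]|]; rewrite /three_dist /=; lra.
- by case=> [[]|] /=; move: e0 => /andP[]; lra.
- by rewrite !big_ord_recl big_ord0 /=; lra.
Defined.

Lemma two_mu e (e01 : 0 < e < 1) (B : set bool) :
  mm_mu (two_space e01) B =
  (if `[< B true >] then 1 - e else 0) + (if `[< B false >] then e else 0).
Proof. by rewrite /= /weight big_ord_recl big_ord1. Qed.

Lemma three_mu e L (e0 : 0 < e < 2^-1) (L1 : 1 <= L) (B : set (option bool)) :
  mm_mu (three_space e0 L1) B =
  (if `[< B None >] then e else 0) + ((if `[< B (Some true) >] then 2^-1 - e else 0)
  + (if `[< B (Some false) >] then 2^-1 else 0)).
Proof. by rewrite /= /weight !big_ord_recl big_ord0 /= addr0. Qed.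

Lemma two_mborel e (e01 : 0 < e < 1) (B : set bool) : mborel (mm_d (two_space e01)) B.
Proof. exact: finite_mborel. Qed.

Lemma three_mborel e L (e0 : 0 < e < 2^-1) (L1 : 1 <= L) (B : set (option bool)) :
  mborel (mm_d (three_space e0 L1)) B.
Proof. exact: finite_mborel. Qed.

(** Sending the far point to [true] preserves the measure, and off that point of mass [e] all
    distances are kept. *)
Lemma box_three_two e L (e0 : 0 < e < 2^-1) (L1 : 1 <= L) (h1 : 0 < (2^-1 : R) < 1) :
  box_dist (three_space e0 L1) (two_space h1) <= e.
Proof.
have e_gt0 : 0 < e by case/andP: e0.
apply: (@box_map (three_space e0 L1) (two_space h1)
  (fun x : option bool => if x is Some b then b else true) [set x | x <> None]).
- exact: ltW.
- move=> B _; split; first exact: three_mborel.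
  rewrite three_mu two_mu /preimage /=.
  by do 2 case: asboolP => _; lra.
- exact: three_mborel.
- by rewrite three_mu asboolF//= !asboolT//; lra.
- move=> [[]|] [[]|] //= _ _; rewrite /three_dist /two_dist /= ?subrr ?normr0; exact: ltW.
Qed.

(** The two near points, now [1/L] apart, are merged into [true]; the far point is at distance
    exactly [1] from both. *)
Lemma box_three_two_scaled e L (e0 : 0 < e < 2^-1) (L1 : 1 <= L) (e01 : 0 < e < 1)
    (Li : 0 < L^-1) :
  box_dist (scale Li (three_space e0 L1)) (two_space e01) <= L^-1.
Proof.
have L0 : L != 0 by rewrite gt_eqF// (lt_le_trans ltr01).
apply: (@box_map (scale Li (three_space e0 L1)) (two_space e01)
  (fun x : option bool => if x is Some b then true else false) setT).
- exact: ltW.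
- move=> B _; split; first by rewrite mborel_scale; exact: three_mborel.
  rewrite [LHS]three_mu two_mu /preimage /=.
  by do 2 case: asboolP => _; lra.
- by rewrite mborel_scale; exact: three_mborel.
- by rewrite [X in _ <= X]three_mu !asboolT//; lra.
- move=> [[]|] [[]|] //= _ _; rewrite /three_dist /two_dist /= ?mulr0 ?mulr1
    ?mulVf// ?subrr ?normr0 ?subr0 ?gtr0_norm//; exact: ltW.
Qed.

(** Discarding the point of mass [e] leaves a single point, whatever the scale. *)
Lemma box_two_point e t (e01 : 0 < e < 1) (t0 : 0 < t) :
  box_dist (scale t0 (two_space e01)) point <= e.
Proof.
have e_gt0 : 0 < e by case/andP: e01.
apply: (@box_map (scale t0 (two_space e01)) point (fun=> tt) [set x : bool | x]).
- exact: ltW.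
- move=> B _; split; first by rewrite mborel_scale; exact: two_mborel.
  rewrite [LHS]two_mu /= /weight big_ord1 /preimage /=.
  by case: asboolP => _; lra.
- by rewrite mborel_scale; exact: two_mborel.
- by rewrite [X in _ <= X]two_mu asboolT// asboolF//; lra.
- by move=> [] [] //= _ _; rewrite /two_dist /= mulr0 subrr normr0 ltW.
Qed.

(** Functions on a point are constant, whereas the 1-Lipschitz indicator of [true] takes the values
    [0] and [1] with mass [1/2] each. *)
Lemma half_le_conc_two_point (h1 : 0 < (2^-1 : R) < 1) :
  2^-1 <= conc_dist (two_space h1) point.
Proof.
apply/ler_addgt0Pr => x x0.
have [|phi [psi [p q [H _]]]] := @conc_dist_lt (two_space h1) point
  (conc_dist (two_space h1) point + x); first by rewrite ltrDl.
set e := conc_dist _ _ + x in H *.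
rewrite leNgt; apply/negP => e2.
pose f (b : bool) : R := b%:R.
have [|_ [g lg <-] [e0 fg]] := H (f \o phi).
  exists f => // a b; rewrite /f /= /two_dist; case: a b => [] [];
  by rewrite /= ?subrr ?subr0 ?sub0r ?normrN ?normr1 ?normr0.
have gE s : g (psi s) = g tt by case: (psi s).
(* Any constant is at distance at least [1/2] from one of [0] and [1]. *)
have [b Hb] : exists b : bool, e < `|f b - g tt|.
  have [ge|ge] := leP (g tt) 2^-1; [exists true|exists false]; rewrite /f /=.
    by rewrite (lt_le_trans e2)// ler_normr; apply/orP; left; lra.
  by rewrite (lt_le_trans e2)// ler_normr; apply/orP; right; lra.
have [_ eb] := p [set c | c = b] (two_mborel _).
have sub : I01 `&` phi @^-1` [set c | c = b] `<=`
    I01 `&` [set s | (e < `|(f \o phi) s - (g \o psi) s|)%R].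
  by move=> s [Is /= sb]; split; [exact: Is|rewrite /= gE sb].
have := le_trans (leb_mono sub) fg; rewrite eb two_mu lee_fin.
by case: (b); [rewrite asboolT// asboolF//|rewrite asboolF// asboolT//]; lra.
Qed.

(** * The quotient [Sigma] *)

Lemma qproj_eq (T : Type) (E : T -> T -> Prop) x y : E x = E y -> qproj E x = qproj E y.
Proof. by move=> xy; apply: eq_exist. Qed.

Lemma qproj_inj (T : Type) (E : T -> T -> Prop) x y : qproj E x = qproj E y -> E x = E y.
Proof. by move=> /(congr1 (@proj1_sig _ _)). Qed.

Lemma qrepK (T : Type) (E : T -> T -> Prop) x : E (qrep (qproj E x)) = E x.
Proof. by rewrite /qrep; case: cid => y /= ->. Qed.

Lemma qrepP (T : Type) (E : T -> T -> Prop) x : (forall y, E y y) ->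
  E x (qrep (qproj E x)) /\ E (qrep (qproj E x)) x.
Proof. by move=> Er; split; [rewrite -qrepK|rewrite qrepK]. Qed.

(** The common ground of the two distances. Smallness is always proved for the box distance and
    passed on by [sd_box]; the only lower bound is [sd_two_point]. *)
Record scalable_dist (delta : mmspace -> mmspace -> R) : Prop := ScalableDist {
  sd_ge0 : forall X Y, 0 <= delta X Y;
  sd_sym : forall X Y, delta X Y = delta Y X;
  sd_tri : forall X Y Z, delta X Z <= delta X Y + delta Y Z;
  sd_box : forall X Y, delta X Y <= box_dist X Y;
  sd_scale : forall t (t0 : 0 < t) X Y,
    delta (scale t0 X) (scale t0 Y) <= Num.max 1 t * delta X Y;
  sd_two_point : forall h : 0 < (2^-1 : R) < 1, 2^-1 <= delta (two_space h) point }.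

Lemma scalable_box : scalable_dist box_dist.
Proof.
split; [exact: box_ge0|exact: box_sym|exact: box_triangle|by []|exact: box_scale|].
by move=> h; apply: le_trans (conc_le_box _ _); exact: half_le_conc_two_point.
Qed.

Lemma scalable_conc : scalable_dist conc_dist.
Proof.
split; [exact: conc_ge0|exact: conc_sym|exact: conc_triangle|exact: conc_le_box| |].
  exact: conc_scale.
exact: half_le_conc_two_point.
Qed.

Lemma mm_iso_one_point X Y : mm_iso X Y -> one_point Y -> one_point X.
Proof.
move=> [f [df _]] [y yP]; have [x _] := mm_inhabited X; exists x => x'.
have [d0 d_eq _ _] := mm_metric X; apply: d_eq.
have [e0 _ _ _] := mm_metric Y.
by have := df x' x; rewrite (yP (f x')) (yP (f x)) e0 mul1r => <-.
Qed.

Lemma mm_iso_scale t (t0 : 0 < t) X Y : mm_iso X Y -> mm_iso (scale t0 X) (scale t0 Y).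
Proof.
move=> [f [df mf]]; exists f; split=> [x y|B].
  by rewrite /= df !mul1r.
by rewrite mborel_scale; exact: mf.
Qed.

Lemma scale_iso t (t0 : 0 < t) X : mm_iso_scaled t X (scale t0 X).
Proof. by exists id; split. Qed.

Lemma scale_iso_inv t (t0 : 0 < t) X : mm_iso_scaled t^-1 (scale t0 X) X.
Proof. by exists id; split => // x y /=; rewrite mulKf// gt_eqF. Qed.

Section QuotientTopology.
Variable delta : mmspace -> mmspace -> R.
Hypothesis H : scalable_dist delta.

Let dM (c c' : MMX) := delta (qrep c) (qrep c').

Notation cls := (qproj mm_iso).
Notation orb := (qproj (@orbit_rel delta)).

Lemma delta_iso0 X Y : mm_iso X Y -> delta X Y = 0.
Proof.
move=> iXY; apply/eqP; rewrite eq_le (sd_ge0 H) andbT.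
by rewrite -(box_mm_iso iXY) (sd_box H).
Qed.

Lemma delta_iso X Y Z : mm_iso X Y -> delta X Z = delta Y Z.
Proof.
move=> iXY; have XY := delta_iso0 iXY.
apply/eqP; rewrite eq_le; apply/andP; split.
  by apply: le_trans (sd_tri H _ Y _) _; rewrite XY add0r.
by apply: le_trans (sd_tri H _ X _) _; rewrite (sd_sym H Y) XY add0r.
Qed.

Lemma dM_cls X Y : dM (cls X) (cls Y) = delta X Y.
Proof.
have [_ iX] := qrepP X mm_iso_refl; have [_ iY] := qrepP Y mm_iso_refl.
by rewrite /dM (delta_iso _ iX) (sd_sym H) (delta_iso _ iY) (sd_sym H).
Qed.

Lemma orbit_rel_refl (c : Xstar_top delta) : orbit_rel c c.
Proof. by exists 1; split => //; exact: mm_iso_refl. Qed.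

Lemma star_subproof X : ~ one_point X -> ~ one_point (qrep (cls X)).
Proof. by move=> nX /mm_iso_one_point H1; apply: nX; apply: H1; case: (qrepP X mm_iso_refl). Qed.

Definition star X (nX : ~ one_point X) : Xstar_top delta :=
  exist _ (cls X) (star_subproof nX).

Lemma sigma_openP (U : set (Sigma_top delta)) : topen (Sigma_top delta) U <->
  forall c, U (orb c) -> exists2 r, 0 < r &
    forall c', dM (proj1_sig c) (proj1_sig c') < r -> U (orb c').
Proof.
split=> [[V [oV UV]] c Uc|HU].
  have UVE c' : U (orb c') <-> V (proj1_sig c').
    by have := congr1 (fun A => A c') UV; rewrite /preimage /= => ->.
  have [r [r0 rV]] := oV _ ((UVE c).1 Uc).
  by exists r => // c' /rV /UVE.
(* This is the largest open set of the whole space whose trace on the complement of the one-point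
   class lies in the preimage of [U]. *)
pose V (m : MMX) := exists2 r, 0 < r &
  forall c' : Xstar_top delta, dM m (proj1_sig c') < r -> U (orb c').
exists V; split.
  move=> m [r r0 rU]; exists (r / 2); split; first by lra.
  move=> m' /= mm'; exists (r / 2); first by lra.
  move=> c' m'c'; apply: rU; apply: le_lt_trans (sd_tri H _ (qrep m') _) _.
  by move: mm' m'c'; rewrite /mball /dM /=; lra.
apply/seteqP; split=> c; first exact: HU.
move=> [r r0]; apply; apply: le_lt_trans r0.
by rewrite /dM (delta_iso0 (mm_iso_refl _)).
Qed.

Lemma orb_scale X t (t0 : 0 < t) (nX : ~ one_point X) (nY : ~ one_point (scale t0 X)) :
  orb (star nX) = orb (star nY).
Proof.
apply: qproj_eq; apply/funext => c; apply/propext.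
have [iX iX'] := qrepP X mm_iso_refl; have [iY iY'] := qrepP (scale t0 X) mm_iso_refl.
have tV : 0 < t^-1 by rewrite invr_gt0.
split=> -[s [s0 sc]].
  exists (s * (1 * (t^-1 * 1))); split; first by rewrite mulr1 mul1r mulr_gt0.
  apply: mm_iso_scaled_trans sc => //; apply: mm_iso_scaled_trans iX => //.
  exact: mm_iso_scaled_trans iY' (scale_iso_inv _ _).
exists (s * (1 * (t * 1))); split; first by rewrite mulr1 mul1r mulr_gt0.
apply: mm_iso_scaled_trans sc => //; apply: mm_iso_scaled_trans iY => //.
exact: mm_iso_scaled_trans iX' (scale_iso _ _).
Qed.

(** * Failure of regularity of the quotient *)

Let half01 : 0 < (2^-1 : R) < 1. Proof. by apply/andP; split; lra. Qed.
Let two := two_space half01.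

Lemma two_space_not_point e (e01 : 0 < e < 1) : ~ one_point (two_space e01).
Proof. by move=> [x xP]; have := xP true; rewrite -(xP false). Qed.

Lemma three_space_not_point e L (e0 : 0 < e < 2^-1) (L1 : 1 <= L) :
  ~ one_point (three_space e0 L1).
Proof. by move=> [x xP]; have := xP None; rewrite -(xP (Some true)). Qed.

Lemma scale_not_point t (t0 : 0 < t) X : ~ one_point X -> ~ one_point (scale t0 X).
Proof. by []. Qed.

(** The free scale [t] makes this a condition on orbits; the radius is half the bound in
    [sd_two_point]. *)
Let near_two (c : MMX) := exists t (t0 : 0 < t), delta (scale t0 (qrep c)) two < 4^-1.

Let near_two_orbit (c c' : Xstar_top delta) : orbit_rel c c' ->
  near_two (proj1_sig c) -> near_two (proj1_sig c').
Proof.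
move=> [s [s0 cc']] [t [t0 ct]]; exists (t / s), (divr_gt0 t0 s0).
by rewrite -(delta_iso _ (mm_iso_scale_orbit s0 t0 (divr_gt0 t0 s0) cc')).
Qed.

Let W : set (Sigma_top delta) := [set s | near_two (proj1_sig (qrep s))].

Let W_orb c : W (orb c) <-> near_two (proj1_sig c).
Proof.
have [c1 c2] := qrepP c orbit_rel_refl.
by split; [exact: near_two_orbit c2|exact: near_two_orbit c1].
Qed.

Let W_open : topen (Sigma_top delta) W.
Proof.
apply/sigma_openP => c /W_orb[t [t0 ct]].
have M1 : 1 <= Num.max 1 t by rewrite le_max lexx.
have M0 : 0 < Num.max 1 t by exact: lt_le_trans M1.
(* Scaling by [t] is Lipschitz with constant [max 1 t], so the slack in the strict inequality is
   divided by it. *)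
exists ((4^-1 - delta (scale t0 (qrep (proj1_sig c))) two) / Num.max 1 t).
  by rewrite divr_gt0// subr_gt0.
move=> c'; rewrite /dM ltr_pdivlMr// mulrC => cc'; apply/W_orb; exists t, t0.
have := sd_tri H (scale t0 (qrep (proj1_sig c'))) (scale t0 (qrep (proj1_sig c))) two.
have := sd_scale H t0 (qrep (proj1_sig c')) (qrep (proj1_sig c)).
by rewrite (sd_sym H (qrep (proj1_sig c'))); move: cc'; lra.
Qed.

Let W_two : W (orb (star (@two_space_not_point _ half01))).
Proof.
apply/W_orb; exists 1, ltr01.
have [_ i] := qrepP two mm_iso_refl.
rewrite (delta_iso _ (mm_iso_scale ltr01 i)).
have j : mm_iso two (scale ltr01 two) := scale_iso ltr01 two.
by rewrite -(delta_iso _ j) (delta_iso0 (mm_iso_refl two)); lra.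
Qed.

(** A rescaled copy within [1/4] of [two] is also within [e] of [point], which would force
    [1/2 < 1/4 + e]. *)
Let W_small e (e01 : 0 < e < 1) : e <= 4^-1 ->
  ~ W (orb (star (@two_space_not_point _ e01))).
Proof.
move=> e4 /W_orb[t [t0]] /=.
have [_ i] := qrepP (two_space e01) mm_iso_refl.
rewrite (delta_iso _ (mm_iso_scale t0 i)) => lt4.
have := le_trans (sd_box H _ _) (box_two_point e01 t0).
have := sd_tri H two (scale t0 (two_space e01)) point.
have := sd_two_point H half01; rewrite -/two.
by rewrite (sd_sym H two (scale _ _)); move: lt4; lra.
Qed.

(* [Sigma] is not regular at the orbit of the two-point space: a third point
   of mass [e] placed at distance [L] is invisible at scale [1], whereas after
   rescaling by [1 / L] it is what remains. *)
Lemma no_sigma_embedding (f : Sigma_top delta -> X_top delta) : tcont f ->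
  ~ (forall U, topen (Sigma_top delta) U -> exists2 V, topen (X_top delta) V & U = f @^-1` V).
Proof.
move=> cf /(_ _ W_open)[V oV WE].
have WEP s : W s <-> V (f s) by rewrite WE.
pose x0 := f (orb (star (@two_space_not_point _ half01))).
have [r [r0 rV]] := oV x0 ((WEP _).1 W_two).
have ball_open y s : topen (X_top delta) (mball dM y s).
  by apply: mball_mopen => a b c; exact: (sd_tri H).
have fball c : dM x0 (f (orb c)) < r / 2 -> exists2 s, 0 < s &
    forall c', dM (proj1_sig c) (proj1_sig c') < s -> dM x0 (f (orb c')) < r / 2.
  exact: (sigma_openP _).1 (cf _ (ball_open x0 (r / 2))) c.
have dM0 y : dM y y = 0 by exact: delta_iso0 (mm_iso_refl _).
have [|r1 r10 Hr1] := fball (star (@two_space_not_point _ half01)); first by rewrite -/x0 dM0; lra.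
(* The first bound brings the three-point space within [r1] of [two]; the second keeps the weights
   positive and makes [W_small] applicable. *)
pose e := Num.min (r1 / 2) 8^-1.
have e_r1 : e <= r1 / 2 by rewrite ge_min lexx.
have e8 : e <= 8^-1 by rewrite ge_min lexx orbT.
have e0 : 0 < e by rewrite lt_min; apply/andP; split; lra.
have e01 : 0 < e < 1 by rewrite e0 /=; lra.
have e02 : 0 < e < 2^-1 by rewrite e0 /=; lra.
pose z := f (orb (star (@two_space_not_point _ e01))).
(* The ball of radius [r] at [x0] lies in [V], while the orbit mapped to [z] is not in [W]. *)
have far : r <= dM x0 z.
  rewrite leNgt; apply/negP => /rV /WEP; apply: W_small; lra.
have [|r2 r20 Hr2] := (sigma_openP _).1 (cf _ (ball_open z (r / 2)))
    (star (@two_space_not_point _ e01)).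
  by rewrite /mball /= -/z dM0; lra.
(* Then [1/L <= r2 / 2], so the space rescaled by [1/L] is within [r2] of the two-point space with
   masses [1 - e] and [e]. *)
pose L := Num.max 1 (2 / r2).
have L1 : 1 <= L by rewrite le_max lexx.
have Lr : L^-1 <= r2 / 2.
  have : 2 / r2 <= L by rewrite le_max lexx orbT.
  rewrite ler_pdivrMr// -[L^-1]mul1r ler_pdivrMr ?(lt_le_trans ltr01)//; lra.
have Li : 0 < L^-1 by rewrite invr_gt0 (lt_le_trans ltr01).
pose Y := three_space e02 L1.
have nY : ~ one_point Y := @three_space_not_point _ _ _ _.
have nY' : ~ one_point (scale Li Y) := scale_not_point nY.
have near_x0 : dM x0 (f (orb (star nY))) < r / 2.
  apply: Hr1; rewrite dM_cls (sd_sym H).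
  by apply: le_lt_trans (le_trans (sd_box H _ _) (box_three_two e02 L1 half01)) _; lra.
have near_z : dM z (f (orb (star nY'))) < r / 2.
  apply: Hr2; rewrite dM_cls (sd_sym H).
  by apply: le_lt_trans (le_trans (sd_box H _ _) (box_three_two_scaled e02 L1 e01 Li)) _; lra.
(* Both estimates concern one orbit, so its image is within [r / 2] of both [x0] and [z], against
   [far]. *)
rewrite -(orb_scale nY) in near_z.
have := sd_tri H (qrep x0) (qrep (f (orb (star nY)))) (qrep z).
rewrite [X in _ + X](sd_sym H); move: near_x0 near_z far; rewrite /dM; lra.
Qed.

Lemma sigma_open_slice (A : topsp) (a : A) (O : set (prod_top A (Sigma_top delta))) :
  topen _ O -> topen (Sigma_top delta) [set s | O (a, s)].
Proof.
move=> oO; apply/sigma_openP => c /= Oc.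
have [U [V [oU oV Ua Vc UVO]]] := oO _ Oc.
have [r r0 rV] := (sigma_openP V).1 oV c Vc.
by exists r => // c' /rV Vc'; apply: UVO.
Qed.

End QuotientTopology.

(** * Slices of the product and of the cone *)

Theorem theorem1p1 :
  forall delta : mmspace -> mmspace -> R,
    delta = box_dist \/ delta = conc_dist ->
    ~ homeomorphic (Xstar_top delta) (prod_top Rplus_top (Sigma_top delta)) /\
    ~ homeomorphic (X_top delta) (cone (Sigma_top delta)).
Proof.
move=> delta Hdelta.
have H : scalable_dist delta.
  by case: Hdelta => ->; [exact: scalable_box|exact: scalable_conc].
split=> -[F [G [FK GK cF cG]]].
  (* The slice at height [1], carried by [G] into the space, would embed the quotient. *)
  pose one : Rplus_top := exist _ 1 ltr01.
  apply: (@no_sigma_embedding _ H (fun s => proj1_sig (G (one, s)))).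
    move=> V oV; apply: (sigma_open_slice H one (O := G @^-1` (@proj1_sig _ _ @^-1` V))).
    by apply: cG; exists V.
  move=> U oU.
  (* An open [U] is the slice of the open cylinder over it, whose preimage under [F] is open. *)
  have [|V [oV UV]] := cF [set p | U p.2].
    move=> p Up; exists setT, U; split => //; last by move=> q [].
    by exists setT; split => //; exact: openT.
  exists V => //; apply/seteqP; split=> s.
    have := congr1 (fun A => A (G (one, s))) UV.
    by rewrite /preimage /= GK => <-.
  have := congr1 (fun A => A (G (one, s))) UV.
  by rewrite /preimage /= GK => <-.
pose one : Rnonneg_top := exist _ 1 ler01.
pose E (p q : prod_top (Sigma_top delta) Rnonneg_top) :=
  p = q \/ (proj1_sig p.2 = 0 /\ proj1_sig q.2 = 0).
(* The cone has the quotient as first factor, [sigma_open_slice] as second. *)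
pose swap (p : prod_top Rnonneg_top (Sigma_top delta)) :
  prod_top (Sigma_top delta) Rnonneg_top := (p.2, p.1).
apply: (@no_sigma_embedding _ H (fun s => G (qproj E (s, one)))).
  move=> V oV.
  apply: (sigma_open_slice H one (O := swap @^-1` (qproj E @^-1` (G @^-1` V)))).
  move=> p /(cG _ oV)[A [B [oA oB Ap Bp AB]]].
  by exists B, A; split => // q [Bq Aq]; apply: AB.
move=> U oU.
(* The cone over [U] without its apex: at positive height classes are singletons, so [N] is open and
   its slice at height [1] is [U]. *)
pose N : set (cone (Sigma_top delta)) :=
  [set q | exists s x, [/\ q = qproj E (s, x), 0 < proj1_sig x & U s]].
have qE s x s' x' : 0 < proj1_sig x' ->
    qproj E (s, x) = qproj E (s', x') -> (s, x) = (s', x').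
  move=> x'0 eE; have EE := qproj_inj eE; have : E (s, x) (s', x') by rewrite EE; left.
  by case=> // -[_ /= x'E]; rewrite x'E ltxx in x'0.
have NE s x : 0 < proj1_sig x -> N (qproj E (s, x)) <-> U s.
  move=> x0; split=> [[s' [x' [eE x'0 Us']]]|Us]; last by exists s, x.
  by have [-> _] := qE _ _ _ _ x'0 eE.
exists (F @^-1` N).
  apply: cF => -[s x] [s' [x' [eE x'0 Us']]]; have [-> xx'] := qE _ _ _ _ x'0 eE.
  exists U, [set y | 0 < proj1_sig y]; split => //.
  - by exists `]0, +oo[%classic; split; [exact: interval_open|
      apply/seteqP; split=> y; rewrite /= in_itv /= andbT].
  - by rewrite /= xx'.
  - by move=> [t y] [/= Ut y0]; apply/NE.
by apply/seteqP; split=> s; rewrite /preimage /= GK => /NE; apply.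
Qed.
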